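(* Let $p,q\in(M,\tau)$ be Hermitian and freely independent with $\mu_p=a\delta_\alpha+(1-a)\delta_{\alpha'}$, $\mu_q=b\delta_\beta+(1-b)\delta_{\beta'}$, where $a,b\in(0,1)$, $\alpha\ne\alpha'$ and $\beta\neq\beta'$ are real, and let $X=p+iq$. For every quaternion $Q=\begin{pmatrix}A&i\overline B\\ iB&\overline A\end{pmatrix}\in\mathbb{H}$ such that $g\notin I_p\cup\{0\}$ and $g^I\notin I_q\cup\{0\}$, $$\mathcal{B}_{\mathbf X}(Q)=\begin{pmatrix}k+ik'-l\overline A& l\,i\overline B\\ l\,iB& k-ik'-lA\end{pmatrix},$$ where $$k=\beta_p(g),\qquad k'=\beta_q(g^I),\qquad l=\beta_p'(g)+\beta_q'(g^I)+\frac1{\det Q}.$$ Moreover, $\mathcal{B}_{\mathbf X}$ is continuous on this subset of $\mathbb{H}$ and on no larger domain (it does not extend continuously to any further point of $\mathbb{H}$), and $$\lim_{Q\to0}|\mathcal{B}_{\mathbf X}(Q)|=\infty .$$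
   Context: $(M,\tau)$ is a von Neumann algebra with faithful normal tracial state. Quaternions: $\mathbb{H}=\left\{Q=\begin{pmatrix}A&i\overline B\\ iB&\overline A\end{pmatrix}:A,B\in\mathbb{C}\right\}\subset M_2(\mathbb{C})$. Write $A=x_0+ix_3$, $B=x_1+ix_2$ with $x_j\in\mathbb{R}$. A complex number $A$ is identified with the quaternion having that $A$ and $B=0$, i.e. $\mathrm{diag}(A,\overline A)$; in particular $i$ is $\mathrm{diag}(i,-i)$. $|Q|=\sqrt{\det Q}=\sqrt{|A|^2+|B|^2}$. For $Q\in\mathbb{H}$: $g=x_0+i\sqrt{x_1^2+x_2^2+x_3^2}$ is the eigenvalue of $Q$ with non-negative imaginary part (the other is $\overline g$), and $g^I=-x_3+i\sqrt{x_0^2+x_1^2+x_2^2}$ is the eigenvalue of $Qi$ with non-negative imaginary part. $\sqrt{\cdot}$ is the principal square root. $D_p(w)=((\alpha'-\alpha)w+(1-2a))^2+4a(1-a)$, $D_q(w)=((\beta'-\beta)w+(1-2b))^2+4b(1-b)$, $$I_p=\Big\{-\tfrac{1-2a}{\alpha'-\alpha}+iy:|y|>\tfrac{2\sqrt{a(1-a)}}{|\alpha'-\alpha|}\Big\},\quad I_q=\Big\{-\tfrac{1-2b}{\beta'-\beta}+iy:|y|>\tfrac{2\sqrt{b(1-b)}}{|\beta'-\beta|}\Big\}.$$ $B_p(w)=\frac{\alpha+\alpha'}2+\frac{1+\sqrt{D_p(w)}}{2w}$ is the inverse of the Cauchy transform $G_p(z)=\tau[(z-p)^{-1}]$ (near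 $z=\infty$), defined for $w\in\mathbb{C}\setminus(I_p\cup\{0\})$; similarly $B_q(w)=\frac{\beta+\beta'}2+\frac{1+\sqrt{D_q(w)}}{2w}$ for $w\in\mathbb{C}\setminus(I_q\cup\{0\})$. $\mathcal{B}_{\mathbf p}(Q)$ is the quaternion determined by $\ker(\mathcal{B}_{\mathbf p}(Q)-B_p(\lambda))=\ker(Q-\lambda)$ for each eigenvalue $\lambda$ of $Q$; similarly $\mathcal{B}_{\mathbf q}$. The Inverse Quaternionic Green's function of $X$ is $\mathcal{B}_{\mathbf X}(Q)=\mathcal{B}_{\mathbf p}(Q)+i\,\mathcal{B}_{\mathbf q}(Qi)-Q^{-1}$; it is the functional inverse (near $0$) of $\mathcal{G}_{\mathbf X}(Q)=\mathrm{bTr}[(Q-\mathrm{diag}(X,X^* ))^{-1}]$, where $\mathrm{bTr}$ applies $\tau$ entrywise to $2\times2$ matrices over $M$. For $w\in\mathbb{C}\setminus(I_p\cup\mathbb{R})$, $$\beta_p(w)=\tfrac{\alpha+\alpha'}2+\tfrac12\tfrac{\sqrt{D_p(w)}-\sqrt{D_p(\overline w)}}{w-\overline w},\qquad \beta_p'(w)=\tfrac1{2|w|^2}\Big(-1+\tfrac{\overline w\sqrt{D_p(w)}-w\sqrt{D_p(\overline w)}}{w-\overline w}\Big),$$ and for real $t$ (with $t\ne0$ in the second formula) $$\beta_p(t)=\tfrac{\alpha+\alpha'}2+\tfrac12\tfrac{(\alpha'-\alpha)((\alpha'-\alpha)t+(1-2a))}{\sqrt{D_p(t)}},\qquad \beta_p'(t)=\tfrac1{2t^2}\Big(-1+\tfrac{-(1-2a)(\alpha'-\alpha)t-1}{\sqrt{D_p(t)}}\Big).$$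 $\beta_q,\beta_q'$ are given by the same formulas with $(\alpha,\alpha',a,D_p,I_p)$ replaced by $(\beta,\beta',b,D_q,I_q)$. *)

(* Defs.v *)
From HB Require Import structures.
From mathcomp Require Import all_boot all_order all_algebra complex.
From mathcomp Require Import all_classical all_reals all_analysis.

Set Implicit Arguments.
Unset Strict Implicit.
Unset Printing Implicit Defensive.

Import Order.TTheory GRing.Theory Num.Theory.
Import numFieldNormedType.Exports.

Local Open Scope classical_set_scope.
Local Open Scope ring_scope.

(* Tracial von Neumann algebras, concretely: *-algebras of operators on a
   Hilbert space that are equal to their bicommutant. *)
Section VonNeumann.
Variables (R : realType) (H : lmodType R[i]).
(* Linear in the first variable, conjugate-linear in the second. *)
Variable ip : {dot H for (@Num.conj R[i])}.

Definition hnorm (x : H) : R := Num.sqrt (complex.Re (ip x x)).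

Definition hilbert : Prop := forall u : nat -> H,
  (forall e : R, 0 < e -> exists N : nat, forall m n : nat,
     (N <= m)%N -> (N <= n)%N -> hnorm (u m - u n) < e) ->
  exists l : H, forall e : R, 0 < e -> exists N : nat, forall n : nat,
     (N <= n)%N -> hnorm (u n - l) < e.

Definition bounded_op (T : H -> H) : Prop :=
  linear T /\ exists c : R, forall x, hnorm (T x) <= c * hnorm x.

Definition adjoint_op (T S : H -> H) : Prop := forall x y, ip (T x) y = ip x (S y).

Definition hermitian_op (T : H -> H) : Prop := adjoint_op T T.

Definition op_le (S T : H -> H) : Prop := forall x, ip (S x) x <= ip (T x) x.

Definition commutant (M : set (H -> H)) : set (H -> H) :=
  [set T | bounded_op T /\ forall S, M S -> T \o S = S \o T].

Definition von_neumann_algebra (M : set (H -> H)) : Prop :=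
  [/\ M `<=` bounded_op,
      forall T, M T -> exists2 S, M S & adjoint_op T S
    & commutant (commutant M) = M].

(* Only the values of tau on M matter. *)
Definition tracial_state (M : set (H -> H)) (tau : (H -> H) -> R[i]) : Prop :=
  [/\ forall (c : R[i]) S T, M S -> M T ->
        tau (fun x => c *: S x + T x) = c * tau S + tau T,
      forall T, M T -> op_le (fun=> 0) T -> 0 <= tau T,
      tau idfun = 1
    & forall S T, M S -> M T -> tau (S \o T) = tau (T \o S)].

Definition faithful (M : set (H -> H)) (tau : (H -> H) -> R[i]) : Prop :=
  forall T, M T -> op_le (fun=> 0) T -> tau T = 0 -> T = (fun=> 0).

(* T is the supremum of the directed set D, in the order of Hermitian operators. *)
Definition directed_sup (M : set (H -> H)) (D : set (H -> H)) (T : H -> H) : Prop :=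
  [/\ D !=set0,
      forall S1 S2, D S1 -> D S2 -> exists S, [/\ D S, op_le S1 S & op_le S2 S],
      forall S, D S -> op_le S T
    & forall T', M T' -> hermitian_op T' ->
        (forall S, D S -> op_le S T') -> op_le T T'].

Definition normal (M : set (H -> H)) (tau : (H -> H) -> R[i]) : Prop :=
  forall (D : set (H -> H)) (T : H -> H),
    (forall S, D S -> M S /\ op_le (fun=> 0) S) ->
    M T -> hermitian_op T -> directed_sup M D T ->
    forall r : R[i], (forall S, D S -> tau S <= r) -> tau T <= r.

Definition poly_op (f : {poly R[i]}) (T : H -> H) : H -> H :=
  fun x => \sum_(k < size f) f`_k *: iter k T x.

(* Vanishing of tau on alternating products of centered elements of the unital
   algebras generated by p and by q; these are *-algebras when p and q are
   Hermitian.  A letter (true, f) stands for f(p), and (false, f) for f(q). *)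
Definition freely_independent (tau : (H -> H) -> R[i]) (p q : H -> H) : Prop :=
  let ev (u : bool * {poly R[i]}) := poly_op u.2 (if u.1 then p else q) in
  forall w : seq (bool * {poly R[i]}), w != [::] ->
    sorted (fun u v => u.1 != v.1) w ->
    (forall u, u \in w -> tau (ev u) = 0) ->
    tau (foldr (fun u T => ev u \o T) idfun w) = 0.

(* mu is the (compactly supported) law of the Hermitian operator p. *)
Definition has_law (tau : (H -> H) -> R[i]) (p : H -> H)
    (mu : probability (measurableTypeR R) R) : Prop :=
  (exists c : R, mu [set x | c < `|x|] = 0%E) /\
  forall n : nat, tau (iter n p) = (\int[mu]_x (x ^+ n))%:C%C.

End VonNeumann.

(* mu = a delta_s + (1 - a) delta_t *)
Definition two_point_law (R : realType) (mu : probability (measurableTypeR R) R)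
    (a s t : R) : Prop :=
  forall A, measurable A ->
    mu A = (a%:E * dirac s A + (1 - a)%:E * dirac t A)%E.

Section Quaternions.
Variable R : realType.
Local Notation C := R[i].

Definition mx2 (a b c d : C) : 'M[C^o]_2 :=
  \matrix_(j, k) if j == 0 then (if k == 0 then a else b)
                 else (if k == 0 then c else d).

Definition quat (A B : C) : 'M[C^o]_2 :=
  mx2 A ('i * B^*)%C ('i * B)%C (A^*)%C.

Definition quaternions : set 'M[C^o]_2 := [set Q | exists A B, Q = quat A B].

Definition quat_i : 'M[C^o]_2 := quat 'i%C 0.

Definition qnorm (Q : 'M[C^o]_2) : R := Num.sqrt (complex.Re (\det Q)).

(* For A = x0 + i x3 and B = x1 + i x2: the eigenvalues with nonnegative
   imaginary part of Q = quat A B and of Q * quat_i. *)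
Definition eig (A B : C) : C :=
  (complex.Re A +i*
    Num.sqrt (complex.Re B ^+ 2 + complex.Im B ^+ 2 + complex.Im A ^+ 2))%C.

Definition eig_I (A B : C) : C :=
  (- complex.Im A +i*
    Num.sqrt (complex.Re A ^+ 2 + complex.Re B ^+ 2 + complex.Im B ^+ 2))%C.

(* The quaternion Q' with ker (Q' - f lam) = ker (Q - lam) for every eigenvalue
   lam of Q; 0 if there is none.  [eigenvalue] is about row vectors, but a square
   matrix and its transpose have the same eigenvalues. *)
Definition quat_ext (f : C -> C) (Q : 'M[C^o]_2) : 'M[C^o]_2 :=
  xget 0 [set Q' | quaternions Q' /\
    forall lam : C^o, eigenvalue Q lam -> forall v : 'cV[C^o]_2,
      (Q' - (f lam : C^o)%:M) *m v = 0 <-> (Q - lam%:M) *m v = 0].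

End Quaternions.

(* Two-point law a delta_s + (1 - a) delta_t.  [sqrtc] is the principal square
   root, with values i * sqrt |x| on the negative real half-line. *)
Section TwoPoint.
Variables (R : realType) (a s t : R).
Local Notation C := R[i].

Definition disc (w : C) : C :=
  ((t - s)%:C * w + (1 - 2 * a)%:C)%C ^+ 2 + (4 * a * (1 - a))%:C%C.

Definition cut : set C :=
  [set w | complex.Re w = - ((1 - 2 * a) / (t - s)) /\
           2 * Num.sqrt (a * (1 - a)) / `|t - s| < `|complex.Im w| ].

Definition inv_cauchy (w : C) : C :=
  ((s + t) / 2)%:C%C + (1 + sqrtc (disc w)) / (2 * w).

Definition bfun (w : C) : C :=
  if complex.Im w == 0 then
    ((s + t) / 2)%:C%C +
      1 / 2 * (((t - s)%:C * ((t - s)%:C * w + (1 - 2 * a)%:C))%C / sqrtc (disc w))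
  else
    ((s + t) / 2)%:C%C +
      1 / 2 * ((sqrtc (disc w) - sqrtc (disc (w^*)%C)) / (w - (w^*)%C)).

Definition bfun' (w : C) : C :=
  if complex.Im w == 0 then
    1 / (2 * w ^+ 2) *
      (- 1 + (- ((1 - 2 * a) * (t - s))%:C%C * w - 1) / sqrtc (disc w))
  else
    1 / (2 * `|w| ^+ 2) *
      (- 1 + ((w^*)%C * sqrtc (disc w) - w * sqrtc (disc (w^*)%C))
               / (w - (w^*)%C)).

End TwoPoint.

Section InverseGreen.
Variables (R : realType) (a alpha alpha' b beta beta' : R).
Local Notation C := R[i].

(* Inverse quaternionic Green's function of p + iq, where p and q are free with
   laws a delta_alpha + (1 - a) delta_alpha' and
   b delta_beta + (1 - b) delta_beta'. *)
Definition inv_green (Q : 'M[C^o]_2) : 'M[C^o]_2 :=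
  quat_ext (inv_cauchy a alpha alpha') Q
  + quat_i R *m quat_ext (inv_cauchy b beta beta') (Q *m quat_i R)
  - invmx Q.

Definition admissible (A B : C) : Prop :=
  [/\ ~ cut a alpha alpha' (eig A B), eig A B != 0,
      ~ cut b beta beta' (eig_I A B) & eig_I A B != 0].

Definition inv_green_dom : set 'M[C^o]_2 :=
  [set Q | exists A B, Q = quat A B /\ admissible A B].

End InverseGreen.

(* Main.v *)
Require Import Defs.
From HB Require Import structures.
From mathcomp Require Import all_boot all_order all_algebra complex.
From mathcomp Require Import all_classical all_reals all_analysis.
From mathcomp Require Import ring lra.

Import Order.TTheory GRing.Theory Num.Theory.
Import numFieldNormedType.Exports.

Local Open Scope classical_set_scope.
Local Open Scope ring_scope.

(** The inverse Green's function arises from [B_p] and [B_q] by functional calculus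
    on one quaternion [Q] and on [Q i], so that everything comes down to explicit
    real functions of the four coordinates of [Q].

    Write the discriminant [D_p w], at [w = x + i y], as [(u + i v) ^ 2 + kappa]
    with [u = lin x], [v = (t - s) * y] and [kappa > 0].  Away from the cut its
    principal root is [r + i * slope * v], where [r >= 0] is the real part and
    [slope = u / r].  Both [r] and [slope] depend on [v] only through [v ^ 2], so
    they take the same values at [w] and at its conjugate, and
    [B_p w = K - L * conj w] with real [K] and [L] common to [w] and [conj w]
    ([inv_cauchyE]).  A function that acts affinely on both eigenvalues of [Q]
    acts on [Q] by the same affine map, provided that its linear part [L] does
    not vanish ([quat_extE], [blin_neq0]).  This gives [B_p Q = K - L * conj Q];
    applying it to [Q] and to [Q i] gives the matrix formula, in which [K] and
    [L] are the difference quotients [bfun] and [bfun'].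

    Adding the terms in [Q], [Q i] and [Q^-1], the coefficient of [- conj Q] in
    the value becomes
    [l = (x0 * ip - x3 * iq - rp - rq) / (2 * n)], where [n = |Q| ^ 2], [ip] and
    [iq] are the two slopes scaled by [t - s], and [rp] and [rq] are the real
    parts of the two roots ([inv_green_assemble]).  The other three claims are
    then questions about real functions.

    - Continuity: [slope] is continuous off the cut, also at the branch points,
      where [r] vanishes, because [slope ^ 2] is bounded by a continuous function
      that is 0 there ([cvg_slope]).
    - No extension: at a point of the cut, [slope] has opposite nonzero limits
      from the two sides ([cvg_slope_side]).  One can approach a quaternion whose
      [g] is on the cut along two rays on which [g] comes from different sides
      while [g^I] always comes from the same side; the limits of the value along
      the two rays would agree only if [g] were real ([invisible_jump]).  The
      roles of [g] and [g^I] can be exchanged.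
    - Behaviour at 0: [l * n] tends to [- (rp + rq) / 2], a negative number, while
      the other terms stay bounded, so that the norm, which is about [|l| * |Q|],
      grows like the inverse of [|Q|] ([qnorm_inv_green_pinfty]). *)

(** * The real part of the root and the slope *)

Section Root.
Context {R : realType}.
Implicit Types (k u V : R).

(** The real part of [(u + i v) ^ 2 + k], where [V = v ^ 2]. *)
Definition disc_re k u V : R := u ^+ 2 - V + k.

(** The modulus of [(u + i v) ^ 2 + k], whose imaginary part is [2 * u * v]. *)
Definition disc_norm k u V : R :=
  Num.sqrt (disc_re k u V ^+ 2 + 4 * u ^+ 2 * V).

(** The real part of the principal root of [(u + i v) ^ 2 + k]. *)
Definition root_re k u V : R :=
  Num.sqrt ((disc_norm k u V + disc_re k u V) / 2).

(** The imaginary part of the principal root divided by [v].  In this form the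
    quotient also makes sense for real arguments, where [v = 0]. *)
Definition slope k u V : R := u / root_re k u V.

Lemma disc_norm_ge k u V : 0 <= V -> `|disc_re k u V| <= disc_norm k u V.
Proof.
move=> V0; rewrite -sqrtr_sqr ler_wsqrtr // lerDl.
by apply: mulr_ge0 => //; apply: mulr_ge0 => //; exact: sqr_ge0.
Qed.

Lemma sqr_disc_norm k u V : 0 <= V ->
  disc_norm k u V ^+ 2 = disc_re k u V ^+ 2 + 4 * u ^+ 2 * V.
Proof.
move=> V0; rewrite sqr_sqrtr //; apply: addr_ge0; first exact: sqr_ge0.
by apply: mulr_ge0 => //; apply: mulr_ge0 => //; exact: sqr_ge0.
Qed.

Lemma sqr_root_re k u V : 0 <= V ->
  root_re k u V ^+ 2 = (disc_norm k u V + disc_re k u V) / 2.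
Proof.
move=> V0; rewrite sqr_sqrtr // divr_ge0 //.
by have := disc_norm_ge k u V V0; rewrite ler_norml => /andP[]; lra.
Qed.

Lemma root_re_ge0 k u V : 0 <= root_re k u V.
Proof. exact: sqrtr_ge0. Qed.

Lemma root_re_eq0 k u V : 0 <= V -> 0 < k -> root_re k u V = 0 -> u = 0 /\ k <= V.
Proof.
move=> V0 k0 r0.
have /esym := sqr_root_re k u V V0; rewrite r0 expr0n /= => NP.
have N0 : 0 <= disc_norm k u V by exact: sqrtr_ge0.
have NE : disc_norm k u V = - disc_re k u V by lra.
have := sqr_disc_norm k u V V0; rewrite NE sqrrN => /eqP.
rewrite -subr_eq0 opprD addrA subrr add0r oppr_eq0 !mulf_eq0 pnatr_eq0 /=.
have PN : disc_re k u V <= 0 by lra.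
rewrite orbb => /orP[/eqP u0|/eqP V00].
  by split => //; move: PN; rewrite /disc_re u0 expr0n /=; lra.
exfalso; move: PN; rewrite /disc_re V00; have := sqr_ge0 u; lra.
Qed.

(** The real part of the root vanishes only for [u = 0], so the value of
    [slope] given by division by 0 is harmless here. *)
Lemma root_slope k u V : 0 <= V -> 0 < k -> root_re k u V * slope k u V = u.
Proof.
move=> V0 k0; rewrite /slope mulrCA.
have [r0|r0] := eqVneq (root_re k u V) 0; last by rewrite divff ?mulr1.
by have [-> _] := root_re_eq0 k u V V0 k0 r0; rewrite mul0r.
Qed.

(** The square of the imaginary part of the root.  On the cut this fails,
    because there [slope] is [0 / 0 = 0] while the root is purely imaginary. *)
Lemma slope_sqrV k u V : 0 <= V -> 0 < k -> ~ (u = 0 /\ k < V) ->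
  slope k u V ^+ 2 * V = (disc_norm k u V - disc_re k u V) / 2.
Proof.
move=> V0 k0 ncut.
have rE := sqr_root_re k u V V0; have nE := sqr_disc_norm k u V V0.
have [r0|r0] := eqVneq (root_re k u V) 0.
  have [u0 kV] := root_re_eq0 k u V V0 k0 r0.
  have VE : V = k by apply/eqP; rewrite eq_le kV andbT leNgt; apply/negP => ?; apply: ncut.
  move: rE; rewrite r0 /slope r0 invr0 mulr0 expr0n /= mul0r.
  by rewrite /disc_re u0 VE expr0n /= add0r addNr; lra.
have sE := root_slope k u V V0 k0.
have : root_re k u V ^+ 2 != 0 by rewrite expf_neq0.
move=> /mulfI; apply; rewrite mulrA -exprMn sE rE.
transitivity ((disc_norm k u V ^+ 2 - disc_re k u V ^+ 2) / 4); last by field.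
by rewrite nE; field.
Qed.

Lemma root_sub_slope k u V : 0 <= V -> 0 < k -> ~ (u = 0 /\ k < V) ->
  root_re k u V ^+ 2 - slope k u V ^+ 2 * V = disc_re k u V.
Proof. by move=> *; rewrite slope_sqrV // sqr_root_re //; field. Qed.

(** The discontinuity of [slope] across [u = 0] is carried by the sign alone. *)
Lemma slope_sgr k u V : 0 < V -> 0 < k -> u != 0 ->
  slope k u V = Num.sg u * Num.sqrt ((disc_norm k u V - disc_re k u V) / 2 / V).
Proof.
move=> V0 k0 u0; rewrite -slope_sqrV //; first last.
- by case=> u00; rewrite u00 eqxx in u0.
- exact: ltW.
rewrite mulfK ?gt_eqF // sqrtr_sqr [LHS]numEsg; congr (_ * _).
rewrite /slope sgrM sgrV [Num.sg (root_re k u V)]gtr0_sg ?mulr1 //.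
rewrite lt_neqAle root_re_ge0 andbT eq_sym; apply/eqP => r0.
by have [u00 _] := root_re_eq0 k u V (ltW V0) k0 r0; rewrite u00 eqxx in u0.
Qed.

End Root.

Section RootLimits.
Context {R : realType} {T : Type} {F : set_system T} {FF : Filter F}.
Variables (k : R) (u V : T -> R) (u0 V0 : R).
Hypotheses (k_gt0 : 0 < k) (u_cvg : u @ F --> u0) (V_cvg : V @ F --> V0).

Lemma cvg_sqrt (f : T -> R) l : f @ F --> l ->
  (fun x => Num.sqrt (f x)) @ F --> Num.sqrt l.
Proof. by move=> fl; apply: continuous_cvg fl; exact: sqrt_continuous. Qed.

Lemma cvg_disc_re : (fun x => disc_re k (u x) (V x)) @ F --> disc_re k u0 V0.
Proof.
by apply: cvgD; [apply: cvgB => //; exact: cvgM|exact: cvg_cst].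
Qed.

Lemma cvg_disc_norm : (fun x => disc_norm k (u x) (V x)) @ F --> disc_norm k u0 V0.
Proof.
apply: cvg_sqrt; apply: cvgD; first by apply: cvgM; exact: cvg_disc_re.
by apply: cvgM => //; apply: cvgM; [exact: cvg_cst|exact: cvgM].
Qed.

Lemma cvg_root_re : (fun x => root_re k (u x) (V x)) @ F --> root_re k u0 V0.
Proof.
apply: cvg_sqrt; apply: cvgM; last exact: cvg_cst.
by apply: cvgD; [exact: cvg_disc_norm|exact: cvg_disc_re].
Qed.

Let cvg_imag : 0 < V0 ->
  (fun x => Num.sqrt ((disc_norm k (u x) (V x) - disc_re k (u x) (V x)) / 2 / V x))
  @ F --> Num.sqrt ((disc_norm k u0 V0 - disc_re k u0 V0) / 2 / V0).
Proof.
move=> V0_gt0; apply: cvg_sqrt; apply: cvgM; last first.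
  by apply: cvgV => //; rewrite gt_eqF.
apply: cvgM; last exact: cvg_cst.
by apply: cvgB; [exact: cvg_disc_norm|exact: cvg_disc_re].
Qed.

(** Where the real part [r] of the root is positive, [slope] is a quotient of
    continuous functions.  At a branch point the bound
    [slope ^+ 2 <= (norm - re) / (2 * V)] squeezes it to 0. *)
Lemma cvg_slope : 0 <= V0 -> ~ (u0 = 0 /\ k < V0) ->
  (fun x => slope k (u x) (V x)) @ F --> slope k u0 V0.
Proof.
move=> V0_ge0 ncut.
have [r0|r0] := eqVneq (root_re k u0 V0) 0; last first.
  by apply: cvgM => //; apply: cvgV => //; exact: cvg_root_re.
have [u00 kV] := root_re_eq0 k u0 V0 V0_ge0 k_gt0 r0.
have VE : V0 = k.
  by apply/eqP; rewrite eq_le kV andbT leNgt; apply/negP => ?; apply: ncut.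
have V0_gt0 : 0 < V0 by rewrite VE.
rewrite /slope r0 invr0 mulr0; apply/cvgr0Pnorm_lt => e e0.
have := cvg_imag V0_gt0.
have -> : disc_norm k u0 V0 - disc_re k u0 V0 = 0.
  rewrite /disc_norm /disc_re u00 VE expr0n /= add0r addNr.
  by rewrite expr0n /= !(mulr0, mul0r, add0r) sqrtr0 subr0.
rewrite !mul0r sqrtr0 => /cvgr0Pnorm_lt /(_ e e0) H.
have Vpos : \forall x \near F, 0 < V x by exact: (cvgr_gt V0).
near=> x.
have Vx : 0 < V x by near: x.
have [ux|ux] := eqVneq (u x) 0; first by rewrite ux mul0r normr0.
have := slope_sgr k (u x) (V x) Vx k_gt0 ux; rewrite /slope => ->.
rewrite normrM normr_sg ux mul1r; near: x; exact: H.
Unshelve. all: by end_near. Qed.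

(** For [u != 0] the slope is the sign of [u] times a function that is continuous
    across the cut and does not vanish on it; [s] is that sign on the side of
    approach. *)
Lemma cvg_slope_side (s : R) : u0 = 0 -> k < V0 ->
  (\forall x \near F, u x != 0 /\ Num.sg (u x) = s) ->
  (fun x => slope k (u x) (V x)) @ F --> s * Num.sqrt ((V0 - k) / V0).
Proof.
move=> u00 kV side; have V0_gt0 : 0 < V0 by exact: lt_trans kV.
have -> : V0 - k = (disc_norm k u0 V0 - disc_re k u0 V0) / 2.
  rewrite /disc_norm /disc_re u00 expr0n /= mulr0 mul0r addr0 sqrtr_sqr.
  by rewrite ltr0_norm ?add0r; lra.
apply: (@cvg_trans _ ((fun x => s *
  Num.sqrt ((disc_norm k (u x) (V x) - disc_re k (u x) (V x)) / 2 / V x)) @ F)).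
  apply: near_eq_cvg.
  have Vpos : \forall x \near F, 0 < V x by exact: (cvgr_gt V0).
  near=> x.
  have Vx : 0 < V x by near: x.
  have [ux <-] : u x != 0 /\ Num.sg (u x) = s by near: x.
  by rewrite -slope_sgr.
by apply: cvgM; [exact: cvg_cst|exact: cvg_imag].
Unshelve. all: by end_near. Qed.

End RootLimits.

(** * The functions B_p and B_q at a complex number *)

Lemma two_complex {R : realType} : 2 = (2 : R)%:C%C :> R[i].
Proof. by rewrite rmorph_nat. Qed.

Lemma one_complex {R : realType} : 1 = (1 : R)%:C%C :> R[i].
Proof. by []. Qed.

Section InvCauchy.
Context {R : realType} (a s t : R).
Hypotheses (a01 : 0 < a < 1) (neq_st : s != t).
Implicit Types (x y : R).

(** The discriminant at [x + i y] is [(lin x + i (t - s) y) ^ 2 + kappa]; in the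
    definitions below [y2] stands for [y ^ 2], since nothing depends on the sign
    of [y]. *)
Definition kappa : R := 4 * a * (1 - a).
Definition lin x : R := (t - s) * x + (1 - 2 * a).
Definition vsq (y2 : R) : R := (t - s) ^+ 2 * y2.
Definition re_root x (y2 : R) : R := root_re kappa (lin x) (vsq y2).

(** The imaginary part of the root of the discriminant divided by [y]. *)
Definition incr x (y2 : R) : R := (t - s) * slope kappa (lin x) (vsq y2).

(** The coefficients of [inv_cauchy w = bcst - blin * conj w]. *)
Definition bcst x y2 : R := (s + t) / 2 + incr x y2 / 2.
Definition blin x y2 : R := (x * incr x y2 - re_root x y2 - 1) / (2 * (x ^+ 2 + y2)).

Lemma kappa_gt0 : 0 < kappa.
Proof.
by case/andP: a01 => a0 a1; rewrite /kappa; apply: mulr_gt0; [apply: mulr_gt0|]; lra.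
Qed.

Lemma vsq_ge0 y2 : 0 <= y2 -> 0 <= vsq y2.
Proof. by move=> ?; apply: mulr_ge0 => //; exact: sqr_ge0. Qed.

Lemma sub_st_neq0 : t - s != 0.
Proof. by rewrite subr_eq0 eq_sym. Qed.

Lemma cutE x y : Defs.cut a s t (x +i* y)%C <-> lin x = 0 /\ kappa < vsq (y ^+ 2).
Proof.
have c0 := sub_st_neq0; rewrite /Defs.cut /=.
have -> : (2 * Num.sqrt (a * (1 - a)) / `|t - s| < `|y|) = (kappa < vsq (y ^+ 2)).
  rewrite ltr_pdivrMr ?normr_gt0 // -normrM.
  rewrite -(@ltr_pXn2r _ 2) // ?nnegrE ?mulr_ge0 ?sqrtr_ge0 //.
  rewrite exprMn sqr_sqrtr; last by case/andP: a01 => ? ?; apply: mulr_ge0; lra.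
  rewrite real_normK ?num_real // exprMn /kappa /vsq.
  by congr (_ < _); ring.
suff -> : x = - ((1 - 2 * a) / (t - s)) <-> lin x = 0 by [].
rewrite /lin; split=> [->|H]; first by field.
by apply: (mulfI c0); rewrite mulrN mulrCA divff // mulr1; lra.
Qed.

Lemma discE x y : disc a s t (x +i* y)%C =
  (disc_re kappa (lin x) (vsq (y ^+ 2)) +i* (2 * lin x * ((t - s) * y)))%C.
Proof.
rewrite /disc expr2; simpc; congr (_ +i* _)%C; rewrite /disc_re /lin /vsq /kappa; ring.
Qed.

(** The sign in [sqrtc] is that of [2 * u * v], which is the sign of [slope * v]. *)
Lemma sqrtc_disc x y : ~ Defs.cut a s t (x +i* y)%C ->
  sqrtc (disc a s t (x +i* y)%C) = (re_root x (y ^+ 2) +i* (incr x (y ^+ 2) * y))%C.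
Proof.
move=> /cutE ncut; rewrite discE /=.
have V0 : 0 <= vsq (y ^+ 2) by apply: vsq_ge0; exact: sqr_ge0.
have -> : Num.sqrt (disc_re kappa (lin x) (vsq (y ^+ 2)) ^+ 2 +
    (2 * lin x * ((t - s) * y)) ^+ 2) = disc_norm kappa (lin x) (vsq (y ^+ 2)).
  by congr (Num.sqrt (_ + _)); rewrite /vsq; ring.
congr (_ +i* _)%C; rewrite -slope_sqrV //; last exact: kappa_gt0.
have -> : slope kappa (lin x) (vsq (y ^+ 2)) ^+ 2 * vsq (y ^+ 2) =
    (slope kappa (lin x) (vsq (y ^+ 2)) * ((t - s) * y)) ^+ 2.
  by rewrite [X in _ * X]/vsq; ring.
rewrite sqrtr_sqr.
have -> : incr x (y ^+ 2) * y = slope kappa (lin x) (vsq (y ^+ 2)) * ((t - s) * y).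
  by rewrite /incr; ring.
set v := (t - s) * y; set u := lin x; set V := vsq _.
have [u0|u0] := eqVneq u 0.
  by rewrite /slope u0 !(mul0r, mulr0) normr0 mulr0.
have r0 : 0 < root_re kappa u V.
  rewrite lt_neqAle root_re_ge0 andbT eq_sym; apply/eqP => r0.
  by have [u00 _] := root_re_eq0 _ _ _ V0 kappa_gt0 r0; rewrite u00 eqxx in u0.
have [v0|v0] := eqVneq v 0; first by rewrite v0 !mulr0 normr0 mulr0.
rewrite (mulf_eq0 _ v) (mulf_eq0 _ u) pnatr_eq0 (negbTE u0) (negbTE v0) /=.
rewrite [RHS]numEsg; congr (_ * _).
by rewrite /slope !sgrM sgrV (gtr0_sg r0) mulr1 (@gtr0_sg _ 2%:R) ?mul1r.
Qed.

Lemma cutJ x y : Defs.cut a s t (x +i* (- y))%C <-> Defs.cut a s t (x +i* y)%C.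
Proof. by rewrite !cutE sqrrN. Qed.

Lemma normsq_neq0 x y : (x +i* y)%C != 0 :> R[i] -> x ^+ 2 + y ^+ 2 != 0.
Proof. by rewrite eq_complex /= paddr_eq0 ?sqr_ge0 // !sqrf_eq0. Qed.

(** [(1 + r + i y e) / (2 w)] becomes affine in [conj w] after multiplication of
    numerator and denominator by [conj w], since
    [1 + r + i y e = e * w - (x * e - r - 1)]. *)
Lemma inv_cauchyE x y : ~ Defs.cut a s t (x +i* y)%C -> (x +i* y)%C != 0 :> R[i] ->
  inv_cauchy a s t (x +i* y)%C =
  (bcst x (y ^+ 2))%:C%C - (blin x (y ^+ 2))%:C%C * (x +i* (- y))%C.
Proof.
move=> ncut w0; have n0 := normsq_neq0 _ _ w0.
rewrite /inv_cauchy sqrtc_disc // rmorphD -addrA; congr (_ + _).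
have w20 : 2 * (x +i* y)%C != 0 :> R[i] by rewrite mulf_neq0 ?pnatr_eq0.
apply: (mulIf w20); rewrite divfK // two_complex one_complex; simpc.
rewrite /blin; congr (_ +i* _)%C; field => //.
Qed.

(** If [blin] vanished at a nonreal [w], [inv_cauchy w] would be real, although
    the Cauchy transform, its inverse, maps real points to real values.  The
    computation turns [blin = 0] into [kappa = 0] for real [w] as well. *)
Lemma blin_neq0 x y : ~ Defs.cut a s t (x +i* y)%C -> (x +i* y)%C != 0 :> R[i] ->
  blin x (y ^+ 2) != 0.
Proof.
move=> /cutE ncut w0; have n0 := normsq_neq0 _ _ w0.
have y2 := sqr_ge0 y; have V0 := vsq_ge0 _ y2; have k0 := kappa_gt0.
rewrite /blin mulf_neq0 ?invr_neq0 ?mulf_neq0 ?pnatr_eq0 //.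
have r1 := root_slope kappa (lin x) _ V0 k0.
have r2 := root_sub_slope kappa (lin x) _ V0 k0 ncut.
rewrite /incr /re_root; apply/eqP => h.
move: r1 r2 h; set r := root_re _ _ _; set sl := slope _ _ _ => r1 r2 h.
have rE : r = x * ((t - s) * sl) - 1 by lra.
set c := t - s in rE h; have c0 : c != 0 := sub_st_neq0.
set E := c * sl in rE h.
(* [E] and [r = x * E - 1] must satisfy the real and imaginary parts of
   [(r + i y E) ^ 2 = disc w]; eliminating [r] leaves two equations for [E]. *)
have e1 : x * (E ^+ 2 - c ^+ 2) = E + c * (1 - 2 * a).
  have : c * (r * sl) = c * lin x by rewrite r1.
  by rewrite rE /lin -/c /E; lra.
have e2 : (x ^+ 2 + y ^+ 2) * (E ^+ 2 - c ^+ 2) = 0.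
  have e3 : (x ^+ 2 - y ^+ 2) * (E ^+ 2 - c ^+ 2) = 2 * x * (E + c * (1 - 2 * a)).
    by move: r2; rewrite rE /disc_re /lin /vsq -/c /E /kappa; lra.
  by move: e3; rewrite -e1; lra.
move/eqP: e2; rewrite mulf_eq0 (negbTE n0) /= => /eqP e2.
move: e1; rewrite e2 mulr0 => e1.
have EE : E = - (c * (1 - 2 * a)) by lra.
have : c ^+ 2 * kappa = 0 by rewrite /kappa; move: e2; rewrite EE; lra.
by move/eqP; rewrite mulf_eq0 sqrf_eq0 (negbTE c0) (gt_eqF k0).
Qed.

Lemma bfunE x y : ~ Defs.cut a s t (x +i* y)%C ->
  bfun a s t (x +i* y)%C = (bcst x (y ^+ 2))%:C%C.
Proof.
move=> ncut; have ncutJ : ~ Defs.cut a s t (x +i* (- y))%C by rewrite cutJ.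
rewrite /bfun -[conjc (x +i* y)%C]/(x +i* (- y))%C [complex.Im _]/=.
rewrite !sqrtc_disc // sqrrN.
have -> : (bcst x (y ^+ 2))%:C%C = ((s + t) / 2)%:C%C + (incr x (y ^+ 2) / 2)%:C%C.
  by rewrite -rmorphD.
case: eqP => [y0|/eqP y0].
  congr (_ + _); rewrite /incr /slope -/(re_root x (y ^+ 2)) y0 mulr0.
  rewrite two_complex one_complex -/((re_root x (0 ^+ 2))%:C%C).
  rewrite -!(rmorphM, fmorphV, rmorphD) /=; congr (_ %:C)%C.
  by rewrite /lin; ring.
congr (_ + _).
have d0 : ((x +i* y)%C - (x +i* (- y))%C) != 0 :> R[i].
  by rewrite eq_complex /= opprK -mulr2n mulrn_eq0 negb_and y0 orbT.
have -> : (re_root x (y ^+ 2) +i* (incr x (y ^+ 2) * y))%C -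
    (re_root x (y ^+ 2) +i* (incr x (y ^+ 2) * - y))%C =
    (incr x (y ^+ 2))%:C%C * ((x +i* y)%C - (x +i* (- y))%C).
  by simpc; congr (_ +i* _)%C; ring.
rewrite mulfK // two_complex one_complex -fmorphV -!rmorphM; congr (_%:C)%C; ring.
Qed.

Lemma bfun'E x y : ~ Defs.cut a s t (x +i* y)%C -> (x +i* y)%C != 0 :> R[i] ->
  bfun' a s t (x +i* y)%C = (blin x (y ^+ 2))%:C%C.
Proof.
move=> ncut w0; have ncutJ : ~ Defs.cut a s t (x +i* (- y))%C by rewrite cutJ.
have n0 := normsq_neq0 _ _ w0.
have k0 := kappa_gt0; have y2 := sqr_ge0 y; have V0 := vsq_ge0 _ y2.
rewrite /bfun' -[conjc (x +i* y)%C]/(x +i* (- y))%C [complex.Im _]/=.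
rewrite !sqrtc_disc // sqrrN; case: eqP => [y0|/eqP y0].
  have r1 := root_slope kappa (lin x) _ V0 k0.
  have r2 : re_root x (y ^+ 2) ^+ 2 = disc_re kappa (lin x) (vsq (y ^+ 2)).
    rewrite /re_root -root_sub_slope //; last by move/cutE: ncut.
    by rewrite {4}/vsq y0 expr0n !mulr0 subr0.
  have r0 : re_root x (y ^+ 2) != 0.
    apply/eqP => r00; have [_] := root_re_eq0 _ _ _ V0 k0 r00.
    by rewrite y0 expr0n /vsq mulr0; lra.
  have -> : (re_root x (y ^+ 2) +i* (incr x (y ^+ 2) * y))%C =
      (re_root x (y ^+ 2))%:C%C by rewrite y0 mulr0.
  have x0 : x != 0 by move: n0; rewrite y0 expr0n addr0 sqrf_eq0.
  have -> : (x +i* y)%C = x%:C%C by rewrite y0.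
  rewrite two_complex one_complex.
  rewrite -!(rmorphN, rmorphXn, rmorphM, fmorphV, rmorphD) /=; congr (_ %:C)%C.
  have rE : re_root x (y ^+ 2) = (lin x ^+ 2 + kappa) / re_root x (y ^+ 2).
    apply: (mulIf r0); rewrite divfK // -expr2 r2 /disc_re /vsq y0; ring.
  rewrite /blin [X in _ - X - 1]rE /incr /slope -/(re_root x (y ^+ 2)).
  have -> : x ^+ 2 + y ^+ 2 = x ^+ 2 by rewrite y0 expr0n addr0.
  by rewrite /lin /kappa; field; exact/andP.
have d0 : ((x +i* y)%C - (x +i* (- y))%C) != 0 :> R[i].
  by rewrite eq_complex /= opprK -mulr2n mulrn_eq0 negb_and y0 orbT.
have -> : (x +i* (- y))%C * (re_root x (y ^+ 2) +i* (incr x (y ^+ 2) * y))%C -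
    (x +i* y)%C * (re_root x (y ^+ 2) +i* (incr x (y ^+ 2) * - y))%C =
    (x * incr x (y ^+ 2) - re_root x (y ^+ 2))%:C%C * ((x +i* y)%C - (x +i* (- y))%C).
  by simpc; congr (_ +i* _)%C; ring.
rewrite mulfK // -add_Re2_Im2 /= two_complex one_complex.
rewrite -!(rmorphN, rmorphXn, rmorphM, fmorphV, rmorphD) /=; congr (_ %:C)%C.
by rewrite /blin; field.
Qed.

End InvCauchy.

(** * Quaternions as two by two matrices *)

(** Ring identities between complex numbers given by real and imaginary parts. *)
Ltac complex_ring :=
  apply/eqP; rewrite eq_complex /=; apply/andP; split; apply/eqP; ring.

Section QuatAlgebra.
Context {R : realType}.
Local Notation C := R[i].
Implicit Types (A B : C).

Lemma mx2P (M N : 'M[C^o]_2) :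
  M 0 0 = N 0 0 -> M 0 1 = N 0 1 -> M 1 0 = N 1 0 -> M 1 1 = N 1 1 -> M = N.
Proof.
move=> h00 h01 h10 h11; apply/matrixP => i j.
case: (unliftP 0 i) => [i'|] ->; case: (unliftP 0 j) => [j'|] ->;
  rewrite ?(ord1 i') ?(ord1 j') ?lift0 //.
- by have -> : lift 0 0 = 1 :> 'I_2 by exact/val_inj.
- by have -> : lift 0 0 = 1 :> 'I_2 by exact/val_inj.
- by have -> : lift 0 0 = 1 :> 'I_2 by exact/val_inj.
Qed.

Lemma det_mx2 (M : 'M[C^o]_2) : \det M = M 0 0 * M 1 1 - M 0 1 * M 1 0.
Proof.
rewrite (expand_det_row _ 0) !big_ord_recl big_ord0 /cofactor !det_mx11 !mxE /=.
have e1 : lift 0 0 = 1 :> 'I_2 by exact/val_inj.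
have e0 : lift 1 0 = 0 :> 'I_2 by exact/val_inj.
by rewrite !(e1, e0) expr0 expr1 mul1r addr0 mulN1r mulrN.
Qed.

Lemma mulmx2E (M N : 'M[C^o]_2) i j : (M *m N) i j = M i 0 * N 0 j + M i 1 * N 1 j.
Proof.
rewrite mxE !big_ord_recl big_ord0 addr0.
by have -> : lift 0 0 = 1 :> 'I_2 by exact/val_inj.
Qed.

Lemma quatE A B : [/\ quat A B 0 0 = A, quat A B 0 1 = ('i * B^*)%C,
  quat A B 1 0 = ('i * B)%C & quat A B 1 1 = A^*%C].
Proof. by split; rewrite mxE. Qed.

Lemma quatD A B A' B' : quat A B + quat A' B' = quat (A + A') (B + B').
Proof.
have [a1 a2 a3 a4] := quatE A B; have [b1 b2 b3 b4] := quatE A' B'.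
have [c1 c2 c3 c4] := quatE (A + A') (B + B').
apply: mx2P; rewrite [LHS]mxE !(a1, a2, a3, a4, b1, b2, b3, b4, c1, c2, c3, c4) //.
- by rewrite rmorphD mulrDr.
- by rewrite mulrDr.
- by rewrite rmorphD.
Qed.

Lemma quatM A B A' B' : quat A B *m quat A' B' =
  quat (A * A' - B^*%C * B') (A^*%C * B' + B * A').
Proof.
have [a1 a2 a3 a4] := quatE A B; have [b1 b2 b3 b4] := quatE A' B'.
have [c1 c2 c3 c4] := quatE (A * A' - B^*%C * B') (A^*%C * B' + B * A').
apply: mx2P; rewrite mulmx2E !(a1, a2, a3, a4, b1, b2, b3, b4, c1, c2, c3, c4);
  case: (A) (B) (A') (B') => [x0 x3] [x1 x2] [y0 y3] [y1 y2]; by complex_ring.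
Qed.

Lemma det_quat A B : \det (quat A B) =
  (complex.Re A ^+ 2 + complex.Re B ^+ 2 + complex.Im B ^+ 2 + complex.Im A ^+ 2)%:C%C.
Proof.
rewrite det_mx2; have [-> -> -> ->] := quatE A B; case: A B => [x0 x3] [x1 x2] /=.
by complex_ring.
Qed.

Lemma eigenvalue2 (M : 'M[C^o]_2) (lam : C^o) :
  eigenvalue M lam = (\det (M - lam%:M) == 0).
Proof.
rewrite /eigenvalue /eigenspace kermx_eq0 row_free_unit unitmxE unitfE negbK //.
Qed.

Lemma det_quat_sub A B (lam : C) :
  \det (quat A B - lam%:M : 'M[C^o]_2) = (lam - eig A B) * (lam - (eig A B)^*%C).
Proof.
rewrite det_mx2 !mxE /=; case: A B lam => [x0 x3] [x1 x2] [l m].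
rewrite /eig /=; set y := Num.sqrt _.
have yE : y ^+ 2 = x1 ^+ 2 + x2 ^+ 2 + x3 ^+ 2.
  by rewrite sqr_sqrtr // !addr_ge0 ?sqr_ge0.
apply/eqP; rewrite eq_complex /= ?(mulr0n, mulr1n) /=.
by apply/andP; split; apply/eqP; move: yE; clearbody y; lra.
Qed.

Lemma eigenvalue_quat A B (lam : C^o) : eigenvalue (quat A B) lam <->
  lam = eig A B \/ lam = (eig A B)^*%C.
Proof.
rewrite eigenvalue2 det_quat_sub; split.
  by move/eqP/eqP; rewrite mulf_eq0 !subr_eq0 => /orP[] /eqP; [left|right].
by case=> ->; rewrite subrr ?mul0r ?mulr0.
Qed.

Lemma sqr_Im_eig A B : complex.Im (eig A B) ^+ 2 =
  complex.Re B ^+ 2 + complex.Im B ^+ 2 + complex.Im A ^+ 2.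
Proof. by rewrite /= sqr_sqrtr // !addr_ge0 ?sqr_ge0. Qed.

Lemma quat_cayley_hamilton A B (z : C) : complex.Re z = complex.Re A ->
  complex.Im z ^+ 2 = complex.Re B ^+ 2 + complex.Im B ^+ 2 + complex.Im A ^+ 2 ->
  (quat A B - (z : C^o)%:M) *m (quat A B - (z^*%C : C^o)%:M) = 0.
Proof.
case: A B z => [x0 x3] [x1 x2] [l m] /= -> mE.
apply: mx2P; rewrite mulmx2E !mxE /= ?(mulr0n, mulr1n).
all: by apply/eqP; rewrite eq_complex /=; apply/andP; split; apply/eqP; lra.
Qed.

(** Since [d] is not 0, [m + d Q] has the eigenspaces required of [quat_ext].  It
    is the only such matrix: since [(Q - g) (Q - conj g) = 0], a matrix killing
    the eigenspaces of both [g] and [conj g] is 0. *)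
Lemma quat_extE (f : C -> C) A B (m d : R) : d != 0 ->
  f (eig A B) = m%:C%C + d%:C%C * eig A B ->
  f (eig A B)^*%C = m%:C%C + d%:C%C * (eig A B)^*%C ->
  quat_ext f (quat A B) = quat (m%:C%C + d%:C%C * A) (d%:C%C * B).
Proof.
move=> d0 fg fgJ; set Q := quat A B; set g := eig A B in fg fgJ *.
set Q' := quat _ _.
have Q'E : Q' = (m%:C%C : C^o)%:M + (d%:C%C : C^o) *: Q.
  have [a1 a2 a3 a4] := quatE A B.
  have [b1 b2 b3 b4] := quatE (m%:C%C + d%:C%C * A) (d%:C%C * B).
  apply: mx2P; rewrite ?(b1, b2, b3, b4) !mxE /= ?(mulr0n, mulr1n);
  case: (A) (B) => [x0 x3] [x1 x2]; by complex_ring.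
have flam (lam : C^o) : eigenvalue Q lam -> f lam = m%:C%C + d%:C%C * lam.
  by move/eigenvalue_quat => [] ->.
have Q'sub (lam : C^o) : eigenvalue Q lam ->
    Q' - (f lam : C^o)%:M = (d%:C%C : C^o) *: (Q - lam%:M).
  move=> /flam ->; rewrite Q'E scalerBr scale_scalar_mx (raddfD (@scalar_mx C^o 2)).
  by rewrite opprD addrACA subrr add0r.
have Q'P (lam : C^o) : eigenvalue Q lam -> forall v : 'cV[C^o]_2,
    (Q' - (f lam : C^o)%:M) *m v = 0 <-> (Q - lam%:M) *m v = 0.
  move=> /Q'sub -> v; rewrite -scalemxAl; split=> [/eqP|->]; last by rewrite scaler0.
  rewrite scaler_eq0 => /orP[|/eqP //].
  by rewrite eq_complex /= (negbTE d0).
apply: xget_unique.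
  by split; [exists (m%:C%C + d%:C%C * A), (d%:C%C * B)|exact: Q'P].
move=> Q2 [_ Q2P]; apply/eqP; rewrite -subr_eq0; apply/eqP.
set P := Q2 - Q'.
have Pker (lam : C^o) : eigenvalue Q lam -> forall v : 'cV[C^o]_2,
    (Q - lam%:M) *m v = 0 -> P *m v = 0.
  move=> ev v Qv; have := Q2P _ ev v; have := Q'P _ ev v.
  move=> [_ /(_ Qv) h1] [_ /(_ Qv) h2].
  by rewrite -(subrr (0 : 'cV_2)) -{1}h2 -h1 -mulmxBl opprB addrA addrNK.
have eg : eigenvalue Q g by apply/eigenvalue_quat; left.
have egJ : eigenvalue Q g^*%C by apply/eigenvalue_quat; right.
suff Pv (v : 'cV[C^o]_2) : P *m v = 0.
  by apply/matrixP => i j; have := Pv (delta_mx j 0); rewrite -colE => /colP /(_ i); rewrite !mxE.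
(* A real eigenvalue only occurs when [Q] is a scalar, its own eigenvalue. *)
have [gJ|gJ] := eqVneq g^*%C g.
  apply: (Pker _ eg); suff -> : Q - (g : C^o)%:M = 0 by rewrite mul0mx.
  have y0 : complex.Im g = 0 by move/(congr1 (@complex.Im R)): gJ => /=; lra.
  have := sqr_Im_eig A B; rewrite -/g y0 expr0n /= => /esym/eqP.
  rewrite !paddr_eq0 ?addr_ge0 ?sqr_ge0 // !sqrf_eq0 => /andP[/andP[/eqP b1 /eqP b2] /eqP a2].
  have gE : g = (complex.Re A)%:C%C by rewrite [g]complexE y0 mulr0 addr0.
  rewrite gE; apply: mx2P; rewrite !mxE /= ?(mulr0n, mulr1n);
    case: (A) (B) b1 b2 a2 => [x0 x3] [x1 x2] /= b1 b2 a2;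
    rewrite ?b1 ?b2 ?a2; by complex_ring.
have CH : (Q - (g : C^o)%:M) *m (Q - (g^*%C : C^o)%:M) = 0.
  by apply: quat_cayley_hamilton; rewrite ?sqr_Im_eig.
have CH' : (Q - (g^*%C : C^o)%:M) *m (Q - (g : C^o)%:M) = 0.
  rewrite -{2}(conjcK g); apply: quat_cayley_hamilton => //.
  by rewrite -sqr_Im_eig /= sqrrN.
(* The two products below differ by a nonzero multiple of [P v]. *)
have : P *m ((Q - (g : C^o)%:M) *m v) - P *m ((Q - (g^*%C : C^o)%:M) *m v) = 0.
  by rewrite (Pker _ egJ) ?(Pker _ eg) ?subr0 // mulmxA ?CH ?CH' mul0mx.
rewrite -mulmxBr -mulmxBl opprB addrC addrA addrNK -raddfB mul_scalar_mx -scalemxAr.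
by move/eqP; rewrite scaler_eq0 subr_eq0 (negbTE gJ) => /eqP.
Qed.
End QuatAlgebra.

(** * The matrix formula *)

(** The squares of the imaginary parts of [eig A B] and of [eig_I A B]. *)
Definition imsq {R : realType} (A B : R[i]) : R :=
  complex.Re B ^+ 2 + complex.Im B ^+ 2 + complex.Im A ^+ 2.

Definition imsq_I {R : realType} (A B : R[i]) : R :=
  complex.Re A ^+ 2 + complex.Re B ^+ 2 + complex.Im B ^+ 2.

Definition normsq {R : realType} (A B : R[i]) : R :=
  complex.Re A ^+ 2 + complex.Re B ^+ 2 + complex.Im B ^+ 2 + complex.Im A ^+ 2.

Section Extension.
Context {R : realType}.
Local Notation C := R[i].
Implicit Types (A B : C).

Lemma imsq_ge0 A B : 0 <= imsq A B.
Proof. by rewrite /imsq !addr_ge0 ?sqr_ge0. Qed.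

Lemma imsq_I_ge0 A B : 0 <= imsq_I A B.
Proof. by rewrite /imsq_I !addr_ge0 ?sqr_ge0. Qed.

Lemma eigE A B : eig A B = (complex.Re A +i* Num.sqrt (imsq A B))%C.
Proof. by []. Qed.

Lemma eig_IE A B : eig_I A B = (- complex.Im A +i* Num.sqrt (imsq_I A B))%C.
Proof. by []. Qed.

Lemma imsqE A B : imsq A B = Num.sqrt (imsq A B) ^+ 2.
Proof. by rewrite sqr_sqrtr // imsq_ge0. Qed.

Lemma imsq_IE A B : imsq_I A B = Num.sqrt (imsq_I A B) ^+ 2.
Proof. by rewrite sqr_sqrtr // imsq_I_ge0. Qed.

Lemma imsq_rot A B : imsq ('i * A)%C ('i * B)%C = imsq_I A B.
Proof. by case: A B => [x0 x3] [x1 x2]; rewrite /imsq /imsq_I /=; ring. Qed.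

Lemma Re_rot A : complex.Re ('i * A)%C = - complex.Im A.
Proof. by case: A => [x y] /=; ring. Qed.

Lemma eig_rot A B : eig ('i * A)%C ('i * B)%C = eig_I A B.
Proof. by rewrite eigE eig_IE imsq_rot Re_rot. Qed.

(** Right multiplication by the quaternion unit reduces everything about [eig_I]
    to the corresponding fact about [eig]. *)
Lemma quat_mul_i A B : quat A B *m quat_i R = quat ('i * A)%C ('i * B)%C.
Proof. by rewrite /quat_i quatM !mulr0 subr0 add0r ![_ * 'i%C]mulrC. Qed.

Lemma quat_ext_inv_cauchy (a s t : R) A B : 0 < a < 1 -> s != t ->
  ~ Defs.cut a s t (eig A B) -> eig A B != 0 ->
  quat_ext (inv_cauchy a s t) (quat A B) =
  quat ((bcst a s t (complex.Re A) (imsq A B))%:C%C -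
        (blin a s t (complex.Re A) (imsq A B))%:C%C * A^*%C)
       ((blin a s t (complex.Re A) (imsq A B))%:C%C * B).
Proof.
move=> a01 st; rewrite eigE => ncut g0.
set K := bcst _ _ _ _ _; set L := blin _ _ _ _ _.
have L0 : L != 0 by rewrite /L imsqE; apply: blin_neq0.
have ext (y : R) : y ^+ 2 = imsq A B -> ~ Defs.cut a s t (complex.Re A +i* y)%C ->
    (complex.Re A +i* y)%C != 0 :> C -> inv_cauchy a s t (complex.Re A +i* y)%C =
    (K - 2 * complex.Re A * L)%:C%C + L%:C%C * (complex.Re A +i* y)%C.
  move=> y2 yc yn; rewrite inv_cauchyE // y2 -/K -/L; complex_ring.
have y2 := esym (imsqE A B).
rewrite (quat_extE _ _ _ (K - 2 * complex.Re A * L) L) //.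
- congr (quat _ _).
  by case: (A) => [x0 x3]; complex_ring.
- exact: ext.
- apply: ext; first by rewrite sqrrN.
    by rewrite cutJ.
  by move: g0; rewrite !eq_complex /= oppr_eq0.
Qed.

Lemma normsq_eig A B : eig A B != 0 -> normsq A B != 0.
Proof.
rewrite eigE => /normsq_neq0; rewrite -imsqE /imsq /normsq.
by congr (is_true (negb (_ == _))); ring.
Qed.

Lemma invmx_quat A B : normsq A B != 0 -> invmx (quat A B) =
  quat ((normsq A B)^-1%:C%C * A^*%C) (- ((normsq A B)^-1%:C%C * B)).
Proof.
move=> n0; have QV : quat A B *m
    quat ((normsq A B)^-1%:C%C * A^*%C) (- ((normsq A B)^-1%:C%C * B)) = 1%:M.
  rewrite quatM.
  have -> : A * ((normsq A B)^-1%:C%C * A^*%C) - B^*%C * - ((normsq A B)^-1%:C%C * B) = 1.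
    move: n0; case: (A) (B) => [x0 x3] [x1 x2]; rewrite /normsq /= => n0.
    apply/eqP; rewrite eq_complex /=; apply/andP; split; apply/eqP; field => //.
  have -> : A^*%C * - ((normsq A B)^-1%:C%C * B) + B * ((normsq A B)^-1%:C%C * A^*%C) = 0.
    by ring.
  by apply: mx2P; rewrite !mxE /=; complex_ring.
have [Qu _] := mulmx1_unit QV.
by rewrite -[RHS]mul1mx -(mulVmx Qu) -mulmxA QV mulmx1.
Qed.

Variables (a alpha alpha' b beta beta' : R).
Hypotheses (a01 : 0 < a < 1) (b01 : 0 < b < 1).
Hypotheses (neq_alpha : alpha != alpha') (neq_beta : beta != beta').

Definition green_k A B := bcst a alpha alpha' (complex.Re A) (imsq A B).
Definition green_k' A B := bcst b beta beta' (- complex.Im A) (imsq_I A B).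
Definition green_l A B :=
  blin a alpha alpha' (complex.Re A) (imsq A B) +
  blin b beta beta' (- complex.Im A) (imsq_I A B) + (normsq A B)^-1.

Lemma inv_greenE A B : admissible a alpha alpha' b beta beta' A B ->
  inv_green a alpha alpha' b beta beta' (quat A B) =
  quat ((green_k A B +i* green_k' A B)%C - (green_l A B)%:C%C * A^*%C)
       ((green_l A B)%:C%C * B).
Proof.
move=> [cp gp cq gq]; rewrite /inv_green quat_mul_i.
rewrite quat_ext_inv_cauchy // quat_ext_inv_cauchy ?eig_rot //.
rewrite imsq_rot Re_rot invmx_quat; last exact: normsq_eig.
rewrite /green_k /green_k' /green_l.
set K := bcst _ _ _ _ _; set K' := bcst _ _ _ _ _.
set L := blin _ _ _ _ _; set L' := blin _ _ _ _ _; set n := _^-1.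
have oppq P S : - quat P S = quat (- P) (- S).
  by case: P S => [x0 x3] [x1 x2]; apply: mx2P; rewrite !mxE /=; complex_ring.
rewrite /quat_i quatM oppq !quatD; clearbody K K' L L' n.
by congr (quat _ _); case: (A) (B) => [x0 x3] [x1 x2]; complex_ring.
Qed.

Lemma green_formula A B : admissible a alpha alpha' b beta beta' A B ->
  let k := bfun a alpha alpha' (eig A B) in
  let k' := bfun b beta beta' (eig_I A B) in
  let l := bfun' a alpha alpha' (eig A B) + bfun' b beta beta' (eig_I A B)
           + 1 / \det (quat A B) in
  inv_green a alpha alpha' b beta beta' (quat A B) =
    mx2 (k + 'i * k' - l * A^*)%C (l * ('i * B^*))%C
        (l * ('i * B))%C          (k - 'i * k' - l * A)%C.
Proof.
move=> adm; rewrite inv_greenE //; case: adm => cp gp cq gq.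
rewrite !eigE !eig_IE in cp gp cq gq *.
rewrite !bfunE // !bfun'E // det_quat -/(normsq A B) -imsqE -imsq_IE.
rewrite -/(green_k A B) -/(green_k' A B) div1r -fmorphV -!rmorphD.
rewrite -[_ + _ + _]/(green_l A B).
set K := green_k A B; set K' := green_k' A B; set L := green_l A B.
clearbody K K' L; rewrite /quat.
by congr (mx2 _ _ _ _); case: (A) (B) => [x0 x3] [x1 x2]; complex_ring.
Qed.

End Extension.

(** * The topology of two by two matrices in real coordinates *)

Section QuatTopology.
Context {R : realType}.
Local Notation C := R[i].

(** The inverse of [quat], extended to all matrices by continuous functions. *)
Definition coordA (Q : 'M[C^o]_2) : C := Q 0 0.
Definition coordB (Q : 'M[C^o]_2) : C := - 'i%C * Q 1 0.

Lemma coordA_quat (A B : C) : coordA (quat A B) = A.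
Proof. by rewrite /coordA mxE. Qed.

Lemma coordB_quat (A B : C) : coordB (quat A B) = B.
Proof. by rewrite /coordB mxE /= mulrA mulNr -expr2 sqr_i opprK mul1r. Qed.

Section Filter.
Context {T : Type} {F : set_system T} {FF : Filter F}.

Lemma cvg_Re (f : T -> C^o) (l : C^o) : f @ F --> l ->
  (fun t => complex.Re (f t)) @ F --> complex.Re l.
Proof.
move=> /cvgrPdist_lt fl; apply/cvgrPdist_lt => e e0.
have e0C : 0 < e%:C%C :> C by rewrite ltcR.
apply: filterS (fl _ e0C) => t; rewrite -ltcR; apply: le_lt_trans.
by have := normc_ge_Re (l - f t); case: (l) (f t) => [? ?] [? ?].
Qed.

Lemma cvg_Im (f : T -> C^o) (l : C^o) : f @ F --> l ->
  (fun t => complex.Im (f t)) @ F --> complex.Im l.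
Proof.
move=> /cvgrPdist_lt fl; apply/cvgrPdist_lt => e e0.
have e0C : 0 < e%:C%C :> C by rewrite ltcR.
apply: filterS (fl _ e0C) => t; rewrite -ltcR; apply: le_lt_trans.
case: (l) (f t) => [x y] [x' y'] /=; rewrite normc_def lecR /= -sqrtr_sqr.
by rewrite ler_wsqrtr // lerDr sqr_ge0.
Qed.

Lemma cvg_Complex (u v : T -> R) (u0 v0 : R) : u @ F --> u0 -> v @ F --> v0 ->
  (fun t => (u t +i* v t)%C : C^o) @ F --> ((u0 +i* v0)%C : C^o).
Proof.
move=> /cvgrPdist_lt uc /cvgrPdist_lt vc; apply/cvgrPdist_lt => -[e e'].
rewrite ltcE /= => /andP[/eqP -> e0].
have e20 : 0 < e / 2 by rewrite divr_gt0.
apply: filterS2 (uc _ e20) (vc _ e20) => t ut vt.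
rewrite normc_def ltcR /=.
have : `|u0 - u t| + `|v0 - v t| < e by lra.
apply: le_lt_trans; rewrite -(@ler_pXn2r _ 2) // ?nnegrE ?sqrtr_ge0 ?addr_ge0 //.
rewrite sqr_sqrtr ?addr_ge0 ?sqr_ge0 // [leRHS]sqrrD !real_normK ?num_real //.
by rewrite addrAC lerDl mulrn_wge0 // mulr_ge0.
Qed.

Lemma cvg_mx2 (f : T -> 'M[C^o]_2) (M : 'M[C^o]_2) :
  (fun t => f t 0 0) @ F --> M 0 0 -> (fun t => f t 0 1) @ F --> M 0 1 ->
  (fun t => f t 1 0) @ F --> M 1 0 -> (fun t => f t 1 1) @ F --> M 1 1 ->
  f @ F --> M.
Proof.
move=> /cvg_ballP f00 /cvg_ballP f01 /cvg_ballP f10 /cvg_ballP f11.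
apply/cvg_ballP => e e0; near=> t; split=> // i j.
have e1 : lift 0 0 = 1 :> 'I_2 by exact/val_inj.
case: (unliftP 0 i) => [i'|] ->; case: (unliftP 0 j) => [j'|] ->;
  rewrite ?(ord1 i') ?(ord1 j') ?e1; near: t.
- exact: f11.
- exact: f10.
- exact: f01.
- exact: f00.
Unshelve. all: by end_near. Qed.

Lemma cvg_quat (u0 u1 u2 u3 : T -> R) (l0 l1 l2 l3 : R) :
  u0 @ F --> l0 -> u1 @ F --> l1 -> u2 @ F --> l2 -> u3 @ F --> l3 ->
  (fun t => quat (u0 t +i* u3 t)%C (u1 t +i* u2 t)%C) @ F -->
  quat (l0 +i* l3)%C (l1 +i* l2)%C.
Proof.
move=> c0 c1 c2 c3.
have iE (x y : R) : ('i * (x +i* y))%C = ((- y) +i* x)%C by complex_ring.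
have iJ (x y : R) : ('i * (x +i* y)^*)%C = (y +i* x)%C by complex_ring.
have e00 (A B : C) : quat A B 0 0 = A by have [] := quatE A B.
have e01 (A B : C) : quat A B 0 1 = ('i * B^*)%C by have [] := quatE A B.
have e10 (A B : C) : quat A B 1 0 = ('i * B)%C by have [] := quatE A B.
have e11 (A B : C) : quat A B 1 1 = A^*%C by have [] := quatE A B.
apply: cvg_mx2.
- by rewrite e00; under eq_fun do rewrite e00; exact: cvg_Complex.
- by rewrite e01 iJ; under eq_fun do rewrite e01 iJ; exact: cvg_Complex.
- rewrite e10 iE; under eq_fun do rewrite e10 iE.
  by apply: cvg_Complex => //; exact: cvgN.
- rewrite e11; under eq_fun do rewrite e11.
  by apply: cvg_Complex => //; exact: cvgN.
Qed.

Lemma cvg_entry (f : T -> 'M[C^o]_2) (M : 'M[C^o]_2) i j : f @ F --> M ->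
  (fun t => f t i j : C^o) @ F --> (M i j : C^o).
Proof.
move=> fM; apply: (@cvg_comp _ _ _ f (fun N : 'M[C^o]_2 => N i j : C^o)); first exact: fM.
exact: coord_continuous.
Qed.

Lemma cvg_coordA (f : T -> 'M[C^o]_2) (M : 'M[C^o]_2) : f @ F --> M ->
  (fun t => coordA (f t) : C^o) @ F --> (coordA M : C^o).
Proof. exact: cvg_entry. Qed.

Lemma cvg_coordB (f : T -> 'M[C^o]_2) (M : 'M[C^o]_2) : f @ F --> M ->
  (fun t => coordB (f t) : C^o) @ F --> (coordB M : C^o).
Proof.
move=> fM; have f10 : (fun t => f t 1 0 : C^o) @ F --> (M 1 0 : C^o) by exact: cvg_entry.
exact: (@cvgM C T F FF (fun=> - 'i%C) (fun t => f t 1 0) _ _ (cvg_cst _) f10).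
Qed.

Lemma cvg_qnorm (f : T -> 'M[C^o]_2) (M : 'M[C^o]_2) : f @ F --> M ->
  (fun t => qnorm (f t)) @ F --> qnorm M.
Proof.
move=> fM; apply: cvg_sqrt; apply: cvg_Re.
rewrite det_mx2; under eq_fun do rewrite det_mx2.
have e i j : (fun t => f t i j : C^o) @ F --> (M i j : C^o) by exact: cvg_entry.
have p i j k l := @cvgM C T F FF _ _ _ _ (e i j) (e k l).
exact: (@cvgB C C^o T F FF _ _ _ _ (p 0 0 1 1) (p 0 1 1 0)).
Qed.
End Filter.

End QuatTopology.

(** * One-sided limits and the value in real coordinates *)

Section Increment.
Context {R : realType} (a s t : R).
Hypotheses (a01 : 0 < a < 1) (neq_st : s != t).

Definition on_cut (x y2 : R) : Prop := lin a s t x = 0 /\ kappa a < vsq s t y2.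

(** The absolute value of the one-sided limits of [incr] at a point of the cut. *)
Definition jump (y2 : R) : R :=
  `|t - s| * Num.sqrt ((vsq s t y2 - kappa a) / vsq s t y2).

(** The limit of [incr] when the first coordinate approaches [x] from the side
    given by the sign [sigma]; the side matters only on the cut. *)
Definition side_incr (sigma x y2 : R) : R :=
  if `[< on_cut x y2 >] then sigma * jump y2 else incr a s t x y2.

Lemma jump_gt0 y2 : kappa a < vsq s t y2 -> 0 < jump y2.
Proof.
move=> kV; have V0 := lt_trans (kappa_gt0 a a01) kV.
by rewrite mulr_gt0 ?normr_gt0 ?sub_st_neq0 // sqrtr_gt0 divr_gt0 // subr_gt0.
Qed.

Section Limits.
Context {T : Type} {F : set_system T} {FF : Filter F}.
Variables (x y2 : T -> R) (x0 y20 : R).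
Hypotheses (x_cvg : x @ F --> x0) (y2_cvg : y2 @ F --> y20) (y20_ge0 : 0 <= y20).

Lemma cvg_lin : (fun e => lin a s t (x e)) @ F --> lin a s t x0.
Proof.
by apply: cvgD; [apply: cvgM => //; exact: cvg_cst|exact: cvg_cst].
Qed.

Lemma cvg_vsq : (fun e => vsq s t (y2 e)) @ F --> vsq s t y20.
Proof. by apply: cvgM => //; exact: cvg_cst. Qed.

Lemma cvg_re_root : (fun e => re_root a s t (x e) (y2 e)) @ F --> re_root a s t x0 y20.
Proof. by apply: cvg_root_re; [exact: cvg_lin|exact: cvg_vsq]. Qed.

Lemma cvg_incr : ~ on_cut x0 y20 ->
  (fun e => incr a s t (x e) (y2 e)) @ F --> incr a s t x0 y20.
Proof.
move=> ncut; apply: cvgM; first exact: cvg_cst.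
apply: cvg_slope => //; [exact: kappa_gt0|exact: cvg_lin|exact: cvg_vsq|].
exact: vsq_ge0.
Qed.

Lemma cvg_side_incr (sigma : R) : sigma != 0 ->
  (\forall e \near F, Num.sg (x e - x0) = sigma) ->
  (fun e => incr a s t (x e) (y2 e)) @ F --> side_incr sigma x0 y20.
Proof.
move=> sigma0 side; rewrite /side_incr; case: asboolP => [[u0 kV]|]; last exact: cvg_incr.
have -> : sigma * jump y20 = (t - s) * ((Num.sg (t - s) * sigma) *
    Num.sqrt ((vsq s t y20 - kappa a) / vsq s t y20)).
  by rewrite /jump [`|t - s|]normrEsg; ring.
apply: cvgM; first exact: cvg_cst.
apply: (cvg_slope_side _ _ _ _ _ _ cvg_lin cvg_vsq) => //; first exact: kappa_gt0.
apply: filterS side => e xs.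
have uE : lin a s t (x e) = (t - s) * (x e - x0).
  by rewrite -[LHS]subr0 -[X in _ - X]u0 /lin; ring.
rewrite uE; split; last by rewrite sgrM xs.
rewrite mulf_neq0 ?sub_st_neq0 //.
by apply: contra_neq sigma0 => x00; rewrite -xs x00 subrr sgr0.
Qed.

End Limits.
End Increment.

Section Assembly.
Context {R : realType} (mp mq : R).

(** The value of the inverse Green's function in real coordinates.  The increments
    [ip], [iq] are separate arguments so that they can be replaced by one-sided
    limits.  In [l] the contributions [-1], [-1] of the two [blin] and [2] of
    the inverse of [Q] have cancelled. *)
Definition assemble (x0 x1 x2 x3 ip iq rp rq : R) : 'M[R[i]^o]_2 :=
  let l := (x0 * ip - x3 * iq - rp - rq) /
           (2 * (x0 ^+ 2 + x1 ^+ 2 + x2 ^+ 2 + x3 ^+ 2)) in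
  quat ((mp + ip / 2 - l * x0) +i* (mq + iq / 2 + l * x3))%C
       ((l * x1) +i* (l * x2))%C.

Lemma cvg_assemble {T : Type} {F : set_system T} {FF : Filter F}
    (x0 x1 x2 x3 ip iq rp rq : T -> R) (y0 y1 y2 y3 ip0 iq0 rp0 rq0 : R) :
  x0 @ F --> y0 -> x1 @ F --> y1 -> x2 @ F --> y2 -> x3 @ F --> y3 ->
  ip @ F --> ip0 -> iq @ F --> iq0 -> rp @ F --> rp0 -> rq @ F --> rq0 ->
  y0 ^+ 2 + y1 ^+ 2 + y2 ^+ 2 + y3 ^+ 2 != 0 ->
  (fun e => assemble (x0 e) (x1 e) (x2 e) (x3 e) (ip e) (iq e) (rp e) (rq e)) @ F
  --> assemble y0 y1 y2 y3 ip0 iq0 rp0 rq0.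
Proof.
move=> c0 c1 c2 c3 cip ciq crp crq n0.
have cl : (fun e => (x0 e * ip e - x3 e * iq e - rp e - rq e) /
    (2 * (x0 e ^+ 2 + x1 e ^+ 2 + x2 e ^+ 2 + x3 e ^+ 2))) @ F -->
    (y0 * ip0 - y3 * iq0 - rp0 - rq0) / (2 * (y0 ^+ 2 + y1 ^+ 2 + y2 ^+ 2 + y3 ^+ 2)).
  apply: cvgM; first by do 3?[apply: cvgB => //]; exact: cvgM.
  apply: cvgV; first by rewrite mulf_neq0 ?pnatr_eq0.
  apply: cvgM; first exact: cvg_cst.
  by do 3?[apply: cvgD]; exact: cvgM.
apply: cvg_quat.
- apply: cvgB; last exact: cvgM.
  by apply: cvgD; [exact: cvg_cst|apply: cvgM => //; exact: cvg_cst].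
- exact: cvgM.
- exact: cvgM.
- apply: cvgD; last exact: cvgM.
  by apply: cvgD; [exact: cvg_cst|apply: cvgM => //; exact: cvg_cst].
Qed.
End Assembly.

(** * Continuity, behaviour at 0 and maximality of the domain *)

Section Green.
Context {R : realType} (a alpha alpha' b beta beta' : R).
Hypotheses (a01 : 0 < a < 1) (b01 : 0 < b < 1).
Hypotheses (neq_alpha : alpha != alpha') (neq_beta : beta != beta').
Local Notation C := R[i].
Local Notation adm := (admissible a alpha alpha' b beta beta').
Local Notation BX := (inv_green a alpha alpha' b beta beta').
Local Notation dom := (inv_green_dom a alpha alpha' b beta beta').
Local Notation incr_p := (incr a alpha alpha').
Local Notation incr_q := (incr b beta beta').
Local Notation root_p := (re_root a alpha alpha').
Local Notation root_q := (re_root b beta beta').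
Local Notation asm := (assemble ((alpha + alpha') / 2) ((beta + beta') / 2)).

Lemma admissibleE (A B : C) : adm A B <->
  [/\ ~ on_cut a alpha alpha' (complex.Re A) (imsq A B),
      ~ on_cut b beta beta' (- complex.Im A) (imsq_I A B) & normsq A B != 0].
Proof.
have e0 : (eig A B != 0) = (normsq A B != 0).
  rewrite eigE eq_complex /= sqrtr_eq0 -(@sqrf_eq0 _ (complex.Re A)).
  have -> : (imsq A B <= 0) = (imsq A B == 0) by rewrite [RHS]eq_le imsq_ge0 andbT.
  rewrite -paddr_eq0 ?sqr_ge0 ?imsq_ge0 //; congr (_ != _).
  by rewrite /imsq /normsq; ring.
have e1 : (eig_I A B != 0) = (normsq A B != 0).
  rewrite eig_IE eq_complex /= sqrtr_eq0 -(@sqrf_eq0 _ (- complex.Im A)).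
  have -> : (imsq_I A B <= 0) = (imsq_I A B == 0) by rewrite [RHS]eq_le imsq_I_ge0 andbT.
  rewrite -paddr_eq0 ?sqr_ge0 ?imsq_I_ge0 //; congr (_ != _).
  by rewrite /imsq_I /normsq; ring.
have cp : Defs.cut a alpha alpha' (eig A B) =
    on_cut a alpha alpha' (complex.Re A) (imsq A B).
  by apply/propext; rewrite eigE cutE // -imsqE.
have cq : Defs.cut b beta beta' (eig_I A B) =
    on_cut b beta beta' (- complex.Im A) (imsq_I A B).
  by apply/propext; rewrite eig_IE cutE // -imsq_IE.
rewrite /admissible e0 e1 cp cq.
by split=> [[]|[]].
Qed.

Lemma dom_quat (A B : C) : dom (quat A B) <-> adm A B.
Proof.
split=> [[A' [B' [/[dup] e1 e2 ?]]]|?]; last by exists A, B.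
by rewrite -(coordA_quat A B) e1 coordA_quat -(coordB_quat A B) e2 coordB_quat.
Qed.

Lemma quaternionsE (Q : 'M[C^o]_2) : quaternions Q -> Q = quat (coordA Q) (coordB Q).
Proof. by move=> [A [B ->]]; rewrite coordA_quat coordB_quat. Qed.

Lemma dom_quaternions : dom `<=` @quaternions R.
Proof. by move=> Q [A [B [-> _]]]; exists A, B. Qed.

Lemma inv_green_assemble (A B : C) : adm A B -> BX (quat A B) =
  asm (complex.Re A) (complex.Re B) (complex.Im B) (complex.Im A)
    (incr_p (complex.Re A) (imsq A B)) (incr_q (- complex.Im A) (imsq_I A B))
    (root_p (complex.Re A) (imsq A B)) (root_q (- complex.Im A) (imsq_I A B)).
Proof.
move=> ad; rewrite inv_greenE //; move/admissibleE: ad => [_ _ n0].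
rewrite /assemble -/(normsq A B).
have -> : green_l a alpha alpha' b beta beta' A B =
    (complex.Re A * incr_p (complex.Re A) (imsq A B) -
     complex.Im A * incr_q (- complex.Im A) (imsq_I A B) -
     root_p (complex.Re A) (imsq A B) - root_q (- complex.Im A) (imsq_I A B)) /
    (2 * normsq A B).
  rewrite /green_l /blin.
  have -> : complex.Re A ^+ 2 + imsq A B = normsq A B by rewrite /imsq /normsq; ring.
  have -> : (- complex.Im A) ^+ 2 + imsq_I A B = normsq A B.
    by rewrite /imsq_I /normsq; ring.
  by field.
rewrite /green_k /green_k' /bcst; set l := _ / _; clearbody l.
by congr (quat _ _); case: (A) (B) => [x0 x3] [x1 x2]; complex_ring.
Qed.

Section Limits.
Context {T : Type} {F : set_system T} {FF : Filter F}.
Variables (A B : T -> C) (A0 B0 : C).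
Hypotheses (cA : A @ F --> (A0 : C^o)) (cB : B @ F --> (B0 : C^o)).

Lemma cvg_coords : [/\ (fun t => complex.Re (A t)) @ F --> complex.Re A0,
  (fun t => complex.Im (A t)) @ F --> complex.Im A0,
  (fun t => complex.Re (B t)) @ F --> complex.Re B0 &
  (fun t => complex.Im (B t)) @ F --> complex.Im B0].
Proof.
by split; [exact: (cvg_Re _ _ cA)|exact: (cvg_Im _ _ cA)
          |exact: (cvg_Re _ _ cB)|exact: (cvg_Im _ _ cB)].
Qed.

Lemma cvg_imsq : (fun t => imsq (A t) (B t)) @ F --> imsq A0 B0.
Proof.
have [_ h3 h1 h2] := cvg_coords.
exact: (cvgD (cvgD (cvgM h1 h1) (cvgM h2 h2)) (cvgM h3 h3)).
Qed.

Lemma cvg_imsq_I : (fun t => imsq_I (A t) (B t)) @ F --> imsq_I A0 B0.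
Proof.
have [h0 _ h1 h2] := cvg_coords.
exact: (cvgD (cvgD (cvgM h0 h0) (cvgM h1 h1)) (cvgM h2 h2)).
Qed.

Lemma cvg_normsq : (fun t => normsq (A t) (B t)) @ F --> normsq A0 B0.
Proof.
have [h0 h3 h1 h2] := cvg_coords.
exact: (cvgD (cvgD (cvgD (cvgM h0 h0) (cvgM h1 h1)) (cvgM h2 h2)) (cvgM h3 h3)).
Qed.

Lemma cvg_inv_green (ip iq : R) : (\forall t \near F, adm (A t) (B t)) ->
  normsq A0 B0 != 0 ->
  (fun t => incr_p (complex.Re (A t)) (imsq (A t) (B t))) @ F --> ip ->
  (fun t => incr_q (- complex.Im (A t)) (imsq_I (A t) (B t))) @ F --> iq ->
  (fun t => BX (quat (A t) (B t))) @ F -->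
  asm (complex.Re A0) (complex.Re B0) (complex.Im B0) (complex.Im A0) ip iq
    (root_p (complex.Re A0) (imsq A0 B0)) (root_q (- complex.Im A0) (imsq_I A0 B0)).
Proof.
move=> ad n0 cip ciq.
have [ReA ImA ReB ImB] := cvg_coords.
pose proof (cvg_re_root a alpha alpha' _ _ _ _ ReA cvg_imsq) as rp.
pose proof (cvg_re_root b beta beta' _ _ _ _ (cvgN ImA) cvg_imsq_I) as rq.
pose proof (cvg_assemble ((alpha + alpha') / 2) ((beta + beta') / 2) _ _ _ _ _ _ _ _
  _ _ _ _ _ _ _ _ ReA ReB ImB ImA cip ciq rp rq n0) as lim.
apply: cvg_trans lim.
apply: near_eq_cvg; apply: filterS ad => t ad.
by rewrite inv_green_assemble.
Qed.

End Limits.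

Lemma near_dom (Q0 : 'M[C^o]_2) :
  \forall Q \near within dom (nbhs Q0), adm (coordA Q) (coordB Q).
Proof.
apply: filterS (withinT dom _) => Q dQ.
by apply/dom_quat; rewrite -(quaternionsE _ (dom_quaternions _ dQ)).
Qed.

Lemma inv_green_continuous : {within dom, continuous BX}.
Proof.
apply/subspace_continuousP => Q0 dQ0.
have cA : (fun Q => coordA Q : C^o) @ within dom (nbhs Q0) --> (coordA Q0 : C^o).
  by apply: cvg_coordA; exact: cvg_within.
have cB : (fun Q => coordB Q : C^o) @ within dom (nbhs Q0) --> (coordB Q0 : C^o).
  by apply: cvg_coordB; exact: cvg_within.
have Q0E : Q0 = quat (coordA Q0) (coordB Q0) by apply/quaternionsE/dom_quaternions.
have ad0 : adm (coordA Q0) (coordB Q0) by apply/dom_quat; rewrite -Q0E.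
have [pc qc n0] := (admissibleE _ _).1 ad0.
have [ReA ImA _ _] := cvg_coords _ _ _ _ cA cB.
have BX0 := inv_green_assemble _ _ ad0; rewrite -Q0E in BX0.
rewrite /from_subspace BX0.
pose proof (cvg_inv_green _ _ _ _ cA cB _ _ (near_dom Q0) n0
  (cvg_incr _ _ _ a01 _ _ _ _ ReA (cvg_imsq _ _ _ _ cA cB) (imsq_ge0 _ _) pc)
  (cvg_incr _ _ _ b01 _ _ _ _ (cvgN ImA) (cvg_imsq_I _ _ _ _ cA cB)
    (imsq_I_ge0 _ _) qc)) as lim.
apply: cvg_trans lim.
apply: near_eq_cvg.
by apply: filterS (withinT dom _) => Q /dom_quaternions/quaternionsE <-.
Qed.

Lemma qnorm_quat (A B : C) : qnorm (quat A B) = Num.sqrt (normsq A B).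
Proof. by rewrite /qnorm det_quat. Qed.

(** The squared norm is [(k - l x0) ^ 2 + (k' + l x3) ^ 2 + l ^ 2 (x1 ^ 2 + x2 ^ 2)];
    by [(z - w) ^ 2 >= w ^ 2 / 2 - z ^ 2] it is at least
    [l ^ 2 n / 2 - k ^ 2 - k' ^ 2]. *)
Lemma qnorm_assemble_ge (mp mq x0 x1 x2 x3 ip iq rp rq : R) :
  let n := x0 ^+ 2 + x1 ^+ 2 + x2 ^+ 2 + x3 ^+ 2 in n != 0 ->
  (x0 * ip - x3 * iq - rp - rq) ^+ 2 / (8 * n)
    - (mp + ip / 2) ^+ 2 - (mq + iq / 2) ^+ 2
  <= qnorm (assemble mp mq x0 x1 x2 x3 ip iq rp rq) ^+ 2.
Proof.
move=> n n0; rewrite /assemble -/n qnorm_quat /normsq /=.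
rewrite sqr_sqrtr; last by rewrite !addr_ge0 ?sqr_ge0.
set c := x0 * ip - x3 * iq - rp - rq; set k := mp + ip / 2; set k' := mq + iq / 2.
set l := c / (2 * n).
have -> : c ^+ 2 / (8 * n) = l ^+ 2 * n / 2 by rewrite /l; field.
have h0 := sqr_ge0 (k - l * x0 / 2); have h3 := sqr_ge0 (k' + l * x3 / 2).
have h1 := sqr_ge0 (l * x1); have h2 := sqr_ge0 (l * x2).
by rewrite /n; clearbody l k k'; nra.
Qed.

Lemma lin_off_cut0 : ~ on_cut a alpha alpha' 0 0 /\ ~ on_cut b beta beta' 0 0.
Proof.
have p0 := kappa_gt0 a a01; have q0 := kappa_gt0 b b01.
by split=> -[_]; rewrite /vsq mulr0; lra.
Qed.

Lemma re_root0_gt0 (c s t : R) : 0 < c < 1 -> 0 < re_root c s t 0 0.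
Proof.
move=> c01; rewrite lt_neqAle root_re_ge0 andbT eq_sym; apply/eqP => r0.
have c0 := kappa_gt0 c c01.
by have [] := root_re_eq0 _ _ _ (vsq_ge0 s t _ (lexx 0)) c0 r0; rewrite /vsq mulr0; lra.
Qed.

Lemma qnorm_inv_green_pinfty {T : Type} {F : set_system T} {FF : Filter F}
    (A B : T -> C) : A @ F --> (0 : C^o) -> B @ F --> (0 : C^o) ->
  (\forall t \near F, adm (A t) (B t)) ->
  (fun t => qnorm (BX (quat (A t) (B t)))) @ F --> +oo.
Proof.
move=> cA cB ad.
have [ReA ImA ReB ImB] := cvg_coords _ _ _ _ cA cB.
pose proof (cvg_imsq _ _ _ _ cA cB) as cp.
pose proof (cvg_imsq_I _ _ _ _ cA cB) as cq.
pose proof (cvg_normsq _ _ _ _ cA cB) as cn.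
have z : imsq (0 : C) 0 = 0 by rewrite /imsq /= expr0n /= !addr0.
have zI : imsq_I (0 : C) 0 = 0 by rewrite /imsq_I /= expr0n /= !addr0.
have zn : normsq (0 : C) 0 = 0 by rewrite /normsq /= expr0n /= !addr0.
rewrite z /= in cp; rewrite zI in cq; rewrite zn in cn; rewrite /= in ReA ImA.
have ImAN : (fun t => - complex.Im (A t)) @ F --> (0 : R) by rewrite -oppr0; exact: cvgN.
have [pc qc] := lin_off_cut0.
pose proof (cvg_incr _ _ _ a01 _ _ _ _ ReA cp (lexx 0) pc) as cip.
pose proof (cvg_incr _ _ _ b01 _ _ _ _ ImAN cq (lexx 0) qc) as ciq.
pose proof (cvg_re_root a alpha alpha' _ _ _ _ ReA cp) as crp.
pose proof (cvg_re_root b beta beta' _ _ _ _ ImAN cq) as crq.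
(* [s] is [2 * n * l], whose limit is negative, and [kk] is [k ^ 2 + k' ^ 2]. *)
set s := fun t => complex.Re (A t) * incr_p (complex.Re (A t)) (imsq (A t) (B t)) -
  complex.Im (A t) * incr_q (- complex.Im (A t)) (imsq_I (A t) (B t)) -
  root_p (complex.Re (A t)) (imsq (A t) (B t)) -
  root_q (- complex.Im (A t)) (imsq_I (A t) (B t)).
set s0 := root_p 0 0 + root_q 0 0.
have s0_gt0 : 0 < s0 by rewrite addr_gt0 ?re_root0_gt0.
have cs : s @ F --> - s0.
  have -> : - s0 = 0 * incr_p 0 0 - 0 * incr_q 0 0 - root_p 0 0 - root_q 0 0.
    by rewrite /s0; ring.
  exact: (cvgB (cvgB (cvgB (cvgM ReA cip) (cvgM ImA ciq)) crp) crq).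
set kk := fun t =>
  ((alpha + alpha') / 2 + incr_p (complex.Re (A t)) (imsq (A t) (B t)) / 2) ^+ 2 +
  ((beta + beta') / 2 + incr_q (- complex.Im (A t)) (imsq_I (A t) (B t)) / 2) ^+ 2.
set kk0 := ((alpha + alpha') / 2 + incr_p 0 0 / 2) ^+ 2 +
  ((beta + beta') / 2 + incr_q 0 0 / 2) ^+ 2.
have ckk : kk @ F --> kk0.
  pose proof (cvgD (cvg_cst ((alpha + alpha') / 2)) (cvgM cip (cvg_cst (2^-1 : R)))) as h1.
  pose proof (cvgD (cvg_cst ((beta + beta') / 2)) (cvgM ciq (cvg_cst (2^-1 : R)))) as h2.
  exact: (cvgD (cvgM h1 h1) (cvgM h2 h2)).
have kk0_ge0 : 0 <= kk0 by rewrite addr_ge0 ?sqr_ge0.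
apply/cvgryPge => M; set m := M ^+ 2 + kk0 + 1.
have m_gt0 : 0 < m by rewrite /m; have := sqr_ge0 M; lra.
(* This bound on [n] makes [s ^ 2 / (8 * n) >= m] once [s ^ 2 >= s0 ^ 2 / 4]. *)
have d_gt0 : 0 < s0 ^+ 2 / (32 * m) by rewrite divr_gt0 ?exprn_gt0 ?mulr_gt0.
have near_s : \forall t \near F, s t < - (s0 / 2) by apply: (cvgr_lt _ cs); lra.
have near_n : \forall t \near F, normsq (A t) (B t) < s0 ^+ 2 / (32 * m).
  exact: (cvgr_lt _ cn).
have near_k : \forall t \near F, kk t < kk0 + 1 by apply: (cvgr_lt _ ckk); lra.
near=> t.
have adt : adm (A t) (B t) by near: t.
have st : s t < - (s0 / 2) by near: t.
have nt : normsq (A t) (B t) < s0 ^+ 2 / (32 * m) by near: t.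
have kt : kk t < kk0 + 1 by near: t.
have [_ _ n0] := (admissibleE _ _).1 adt.
have n_gt0 : 0 < normsq (A t) (B t) by rewrite lt_neqAle eq_sym n0 /normsq !addr_ge0 ?sqr_ge0.
rewrite (inv_green_assemble _ _ adt).
set G := assemble _ _ _ _ _ _ _ _ _ _.
suff : M ^+ 2 <= qnorm G ^+ 2.
  have G0 : 0 <= qnorm G by exact: sqrtr_ge0.
  have [M0|M0] := leP M 0; first by move=> _; exact: le_trans M0 G0.
  by rewrite ler_pXn2r // nnegrE // ltW.
apply: le_trans (qnorm_assemble_ge _ _ _ _ _ _ _ _ _ _ n0).
have h : m <= s t ^+ 2 / (8 * normsq (A t) (B t)).
  rewrite ler_pdivlMr; last by rewrite mulr_gt0.
  have h1 : s0 ^+ 2 / 4 <= s t ^+ 2 by nra.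
  have h2 : normsq (A t) (B t) * (32 * m) < s0 ^+ 2 by rewrite -ltr_pdivlMr // mulr_gt0.
  by lra.
by move: h kt; rewrite /m /kk /s /normsq; lra.
Unshelve. all: by end_near. Qed.

Lemma near_affine_neq0 (p q : R) : q != 0 -> \forall e \near 0^'+, p + q * e != 0.
Proof.
move=> q0; have [->|p0] := eqVneq p 0.
  apply: filterS (nbhs_right_gt (0 : R)) => e e0.
  by rewrite add0r mulf_neq0 // gt_eqF.
suff lim : (fun e : R => p + q * e) @ 0^'+ --> p by exact: (cvgr_neq0 _ lim).
apply: cvg_at_right_filter; rewrite -[X in _ --> X]addr0 -[X in _ + X](mulr0 q).
by apply: cvgD; [exact: cvg_cst|apply: cvgM; [exact: cvg_cst|exact: cvg_id]].
Qed.

(** A ray that moves the real parts of both eigenvalues, [g] and [g^I], each in a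
    direction of its own. *)
Definition ray (sigma rho : R) (A : C) (e : R) : C :=
  ((complex.Re A + sigma * e) +i* (complex.Im A + rho * e))%C.

Lemma cvg_ray (sigma rho : R) (A : C) : ray sigma rho A @ 0^'+ --> (A : C^o).
Proof.
have aff (p q : R) : (fun e : R => p + q * e) @ 0^'+ --> p.
  apply: cvg_at_right_filter; rewrite -[X in _ --> X]addr0 -[X in _ + X](mulr0 q).
  by apply: cvgD; [exact: cvg_cst|apply: cvgM; [exact: cvg_cst|exact: cvg_id]].
case: A => x y; exact: (cvg_Complex _ _ _ _ (aff x sigma) (aff y rho)).
Qed.

(** On a cut the real part of the eigenvalue is fixed, so a ray along which it
    moves leaves the cut at once. *)
Lemma ray_admissible (sigma rho : R) (A B : C) : sigma != 0 -> rho != 0 ->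
  \forall e \near 0^'+, adm (ray sigma rho A e) B.
Proof.
move=> s0 r0.
have cs : (alpha' - alpha) * sigma != 0 by rewrite mulf_neq0 // sub_st_neq0.
have cr : - ((beta' - beta) * rho) != 0 by rewrite oppr_eq0 mulf_neq0 // sub_st_neq0.
near=> e; apply/admissibleE; split.
- move=> [+ _]; apply/eqP.
  have -> : lin a alpha alpha' (complex.Re (ray sigma rho A e)) =
      lin a alpha alpha' (complex.Re A) + (alpha' - alpha) * sigma * e.
    by rewrite /lin /=; ring.
  by near: e; exact: near_affine_neq0.
- move=> [+ _]; apply/eqP.
  have -> : lin b beta beta' (- complex.Im (ray sigma rho A e)) =
      lin b beta beta' (- complex.Im A) + - ((beta' - beta) * rho) * e.
    by rewrite /lin /=; ring.
  by near: e; exact: near_affine_neq0.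
- have x0 : complex.Re A + sigma * e != 0 by near: e; exact: near_affine_neq0.
  rewrite gt_eqF // /normsq /= -!addrA ltr_pwDl ?addr_ge0 ?sqr_ge0 //.
  by rewrite exprn_even_gt0.
Unshelve. all: by end_near. Qed.

Section NoExtension.
Variables (A0 B0 : C) (F : 'M[C^o]_2 -> 'M[C^o]_2).
Hypothesis F_ext : forall Q, dom Q -> F Q = BX Q.
Hypothesis F_cont : {within dom `|` [set quat A0 B0], continuous F}.

Lemma ext_ray (sigma rho : R) : sigma != 0 -> rho != 0 ->
  (fun e => BX (quat (ray sigma rho A0 e) B0)) @ 0^'+ --> F (quat A0 B0).
Proof.
move=> s0 r0; pose P e := quat (ray sigma rho A0 e) B0.
have Pdom : \forall e \near 0^'+, dom (P e).
  by apply: filterS (ray_admissible _ _ A0 B0 s0 r0) => e ?; apply/dom_quat.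
have cP : P @ 0^'+ --> quat A0 B0.
  have [h0 h3 _ _] := cvg_coords _ _ _ _ (cvg_ray sigma rho A0) (cvg_cst (B0 : C^o)).
  pose proof (cvg_quat _ _ _ _ _ _ _ _ h0 (cvg_cst (complex.Re B0))
    (cvg_cst (complex.Im B0)) h3) as lim.
  by move: lim; rewrite /P; case: (A0) (B0) => [x0 x3] [x1 x2].
have cF : F @ within (dom `|` [set quat A0 B0]) (nbhs (quat A0 B0)) --> F (quat A0 B0).
  have /subspace_continuousP := F_cont.
  by move=> H; exact: (H (quat A0 B0) (or_intror erefl)).
have cPw : P @ 0^'+ --> within (dom `|` [set quat A0 B0]) (nbhs (quat A0 B0)).
  move=> S /= /cP PS; apply: filterS2 Pdom PS => e Pe; apply; by left.
apply: (@cvg_trans _ ((F \o P) @ 0^'+)).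
  by apply: near_eq_cvg; apply: filterS Pdom => e /F_ext.
exact: (cvg_comp _ _ cPw cF).
Qed.

(** The value of a continuous extension is a limit along each of the four rays,
    and these differ only in the sides from which the two cuts are approached. *)
Lemma ext_side (sigma rho : R) : sigma ^+ 2 = 1 -> rho ^+ 2 = 1 -> normsq A0 B0 != 0 ->
  F (quat A0 B0) =
  asm (complex.Re A0) (complex.Re B0) (complex.Im B0) (complex.Im A0)
    (side_incr a alpha alpha' sigma (complex.Re A0) (imsq A0 B0))
    (side_incr b beta beta' rho (- complex.Im A0) (imsq_I A0 B0))
    (root_p (complex.Re A0) (imsq A0 B0)) (root_q (- complex.Im A0) (imsq_I A0 B0)).
Proof.
move=> s1 r1 n0.
have s0 : sigma != 0 by rewrite -sqrf_eq0 s1 oner_eq0.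
have r0 : rho != 0 by rewrite -sqrf_eq0 r1 oner_eq0.
have rN0 : - rho != 0 by rewrite oppr_eq0.
have sgE (x : R) : x ^+ 2 = 1 -> Num.sg x = x.
  by move=> /eqP; rewrite sqrf_eq1 => /orP[] /eqP ->; rewrite ?sgrN sgr1.
have cA := cvg_ray sigma (- rho) A0.
have cB : (fun=> B0 : C^o) @ (0 : R)^'+ --> (B0 : C^o) by exact: cvg_cst.
have [h0 h3 _ _] := cvg_coords _ _ _ _ cA cB.
pose proof (cvg_imsq _ _ _ _ cA cB) as cp.
pose proof (cvg_imsq_I _ _ _ _ cA cB) as cq.
have sp : \forall e \near (0 : R)^'+,
    Num.sg (complex.Re (ray sigma (- rho) A0 e) - complex.Re A0) = sigma.
  apply: filterS (nbhs_right_gt (0 : R)) => e e0.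
  by rewrite /= addrAC subrr add0r sgrM (gtr0_sg e0) mulr1 sgE.
have sq : \forall e \near (0 : R)^'+,
    Num.sg (- complex.Im (ray sigma (- rho) A0 e) - - complex.Im A0) = rho.
  apply: filterS (nbhs_right_gt (0 : R)) => e e0.
  by rewrite /= opprD opprK addrAC addNr add0r mulNr opprK sgrM (gtr0_sg e0) mulr1 sgE.
pose proof (cvg_side_incr _ _ _ a01 neq_alpha _ _ _ _ h0 cp (imsq_ge0 _ _) _ s0 sp) as lp.
pose proof (cvg_side_incr _ _ _ b01 neq_beta _ _ _ _ (cvgN h3) cq (imsq_I_ge0 _ _) _ r0 sq)
  as lq.
pose proof (cvg_inv_green _ _ _ _ cA cB _ _
  (ray_admissible _ _ A0 B0 s0 rN0) n0 lp lq) as lim.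
exact: (cvg_unique (@norm_hausdorff C 'M[C^o]_2) (ext_ray _ _ s0 rN0) lim).
Qed.

(** At 0 the norm of the extension would have both a finite and an infinite limit. *)
Lemma ext_normsq_neq0 : normsq A0 B0 != 0.
Proof.
apply/eqP => n0.
have [A00 B00] : A0 = 0 /\ B0 = 0.
  move/eqP: n0; rewrite /normsq !paddr_eq0 ?addr_ge0 ?sqr_ge0 // !sqrf_eq0.
  case: (A0) (B0) => [x0 x3] [x1 x2] /=.
  by move=> /andP[/andP[/andP[/eqP -> /eqP ->] /eqP ->] /eqP ->].
have one0 : (1 : R) != 0 by exact: oner_neq0.
pose proof (cvg_qnorm _ _ (ext_ray 1 1 one0 one0)) as lim.
have cA : ray 1 1 A0 @ 0^'+ --> (0 : C^o) by rewrite -[X in _ --> X]A00; exact: cvg_ray.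
have cB : (fun=> B0 : C^o) @ (0 : R)^'+ --> (0 : C^o) by rewrite B00; exact: cvg_cst.
pose proof (qnorm_inv_green_pinfty _ _ cA cB (ray_admissible _ _ A0 B0 one0 one0)) as infty.
move/cvgryPge: infty => /(_ (qnorm (F (quat A0 B0)) + 1)) big.
have small : \forall e \near (0 : R)^'+,
    qnorm (BX (quat (ray 1 1 A0 e) B0)) < qnorm (F (quat A0 B0)) + 1.
  by apply: (cvgr_lt _ lim); rewrite ltrDl.
pose proof (filter_ex (FF := at_right_proper_filter (0 : R)) (filterI big small))
  as [e [ge_e lt_e]].
by have := le_lt_trans ge_e lt_e; rewrite ltxx.
Qed.

(** A jump [J - J'] of one of the two increments changes [l] by
    [x * (J - J') / (2 * n)], so that the matching component of the value jumps
    by [(J - J') / 2 * (1 - x ^+ 2 / n)]. *)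
Lemma invisible_jump (m J J' x n l l' : R) : n != 0 ->
  l - l' = x * (J - J') / (2 * n) ->
  m + J / 2 - l * x = m + J' / 2 - l' * x -> (J - J') * (n - x ^+ 2) = 0.
Proof.
move=> n0 ll e.
have -> : (J - J') * (n - x ^+ 2) = 2 * n * ((J - J') / 2 - x * (J - J') / (2 * n) * x).
  by field.
by rewrite -ll; apply/eqP; rewrite mulf_eq0; apply/orP; right; apply/eqP; lra.
Qed.

(** If one eigenvalue were on its cut, the two rays that differ only in the side
    of that cut would give the same limit, hence [n = x ^ 2] for the real part
    [x] of that eigenvalue, which would then be real; but the cut is not. *)
Lemma ext_admissible : adm A0 B0.
Proof.
have one2 : (1 : R) ^+ 2 = 1 by rewrite expr1n.
have mone2 : (-1 : R) ^+ 2 = 1 by rewrite sqrrN expr1n.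
have n0 := ext_normsq_neq0.
have nE : normsq A0 B0 = complex.Re A0 ^+ 2 + imsq A0 B0 by rewrite /normsq /imsq; ring.
have nIE : normsq A0 B0 = complex.Im A0 ^+ 2 + imsq_I A0 B0.
  by rewrite /normsq /imsq_I; ring.
apply/admissibleE; split=> // cut; have kV := cut.2.
  set J := jump a alpha alpha' (imsq A0 B0).
  have J0 : 0 < J by exact: jump_gt0.
  move: (ext_side 1 1 one2 one2 n0); rewrite (ext_side (-1) 1 mone2 one2 n0).
  set q := side_incr b _ _ _ _ _.
  rewrite /assemble -/(normsq A0 B0) => /(congr1 (fun Q => complex.Re (coordA Q))).
  rewrite !coordA_quat /= /side_incr !asboolT // -/J mulN1r mul1r => /esym.
  move=> /(invisible_jump _ _ _ _ _ _ _ n0) H.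
  have {H} : (J - - J) * (normsq A0 B0 - complex.Re A0 ^+ 2) = 0 by apply: H; field.
  move/eqP; rewrite opprK -mulr2n nE addrAC subrr add0r mulf_eq0 mulrn_eq0 (gt_eqF J0).
  by move=> /eqP y0; move: kV; rewrite y0 /vsq mulr0; have := kappa_gt0 a a01; lra.
set J := jump b beta beta' (imsq_I A0 B0).
have J0 : 0 < J by exact: jump_gt0.
move: (ext_side 1 1 one2 one2 n0); rewrite (ext_side 1 (-1) one2 mone2 n0).
set p := side_incr a _ _ _ _ _.
rewrite /assemble -/(normsq A0 B0) => /(congr1 (fun Q => complex.Im (coordA Q))).
rewrite !coordA_quat /= /side_incr !asboolT // -/J mulN1r mul1r => /esym.
set l := (_ - _ - _ - _) / _; set l' := (_ - _ - _ - _) / _ => e.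
have {e} : (beta + beta') / 2 + J / 2 - l * - complex.Im A0 =
    (beta + beta') / 2 + - J / 2 - l' * - complex.Im A0 by rewrite !mulrN !opprK.
move=> /(invisible_jump _ _ _ _ _ _ _ n0) H.
have {H} : (J - - J) * (normsq A0 B0 - (- complex.Im A0) ^+ 2) = 0.
  by apply: H; rewrite /l /l'; field.
move/eqP; rewrite opprK -mulr2n sqrrN nIE addrAC subrr add0r mulf_eq0 mulrn_eq0 (gt_eqF J0).
by move=> /eqP y0; move: kV; rewrite y0 /vsq mulr0; have := kappa_gt0 b b01; lra.
Qed.

End NoExtension.

Lemma inv_green_no_extension (Q0 : 'M[C^o]_2) : quaternions Q0 -> ~ dom Q0 ->
  ~ exists F : 'M[C^o]_2 -> 'M[C^o]_2,
      (forall Q, dom Q -> F Q = BX Q) /\ {within dom `|` [set Q0], continuous F}.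
Proof.
move=> /quaternionsE -> ndom [F [F_ext F_cont]].
by apply/ndom/dom_quat; exact: ext_admissible F_ext F_cont.
Qed.

Lemma qnorm_inv_green_at0 :
  (fun Q => qnorm (BX Q)) @ within dom (nbhs (0 : 'M[C^o]_2)) --> +oo.
Proof.
have A0 : coordA (0 : 'M[C^o]_2) = 0 by rewrite /coordA mxE.
have B0 : coordB (0 : 'M[C^o]_2) = 0 by rewrite /coordB mxE mulr0.
have cA : (fun Q => coordA Q : C^o) @ within dom (nbhs (0 : 'M[C^o]_2)) --> (0 : C^o).
  by rewrite -[X in _ --> X]A0; apply: cvg_coordA; exact: cvg_within.
have cB : (fun Q => coordB Q : C^o) @ within dom (nbhs (0 : 'M[C^o]_2)) --> (0 : C^o).
  by rewrite -[X in _ --> X]B0; apply: cvg_coordB; exact: cvg_within.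
pose proof (qnorm_inv_green_pinfty _ _ cA cB (near_dom 0)) as lim.
apply: cvg_trans lim; apply: near_eq_cvg.
by apply: filterS (withinT dom _) => Q /dom_quaternions/quaternionsE <-.
Qed.

End Green.

(** * The theorem *)

Theorem theorem5p13 (R : realType)
    (H : lmodType R[i]) (ip : {dot H for (@Num.conj R[i])})
    (M : set (H -> H)) (tau : (H -> H) -> R[i])
    (hilbertH : hilbert ip) (vnM : von_neumann_algebra ip M)
    (tauM : tracial_state ip M tau) (faithful_tau : faithful ip M tau)
    (normal_tau : normal ip M tau)
    (p q X : H -> H) (Mp : M p) (Mq : M q)
    (herm_p : hermitian_op ip p) (herm_q : hermitian_op ip q)
    (free_pq : freely_independent tau p q)
    (a b alpha alpha' beta beta' : R)
    (a01 : 0 < a < 1) (b01 : 0 < b < 1)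
    (neq_alpha : alpha != alpha') (neq_beta : beta != beta')
    (mu_p mu_q : probability (measurableTypeR R) R)
    (law_p : has_law tau p mu_p) (law_q : has_law tau q mu_q)
    (mu_pE : two_point_law mu_p a alpha alpha')
    (mu_qE : two_point_law mu_q b beta beta')
    (XE : X = (fun x => p x + 'i%C *: q x)) :
  let BX := inv_green a alpha alpha' b beta beta' in
  let dom := inv_green_dom a alpha alpha' b beta beta' in
  [/\ forall A B : R[i], admissible a alpha alpha' b beta beta' A B ->
        let k := bfun a alpha alpha' (eig A B) in
        let k' := bfun b beta beta' (eig_I A B) in
        let l := bfun' a alpha alpha' (eig A B) + bfun' b beta beta' (eig_I A B)
                 + 1 / \det (quat A B) in
        BX (quat A B) =
          mx2 (k + 'i * k' - l * A^*)%C (l * ('i * B^*))%C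
              (l * ('i * B))%C          (k - 'i * k' - l * A)%C,
      {within dom, continuous BX},
      forall Q0, quaternions Q0 -> ~ dom Q0 ->
        ~ exists F : 'M[R[i]^o]_2 -> 'M[R[i]^o]_2,
            (forall Q, dom Q -> F Q = BX Q) /\
            {within dom `|` [set Q0], continuous F}
    & (fun Q => qnorm (BX Q)) @ within dom (nbhs (0 : 'M[R[i]^o]_2)) --> +oo].
Proof.
move=> BX dom; split.
- by move=> A B adm; exact: green_formula.
- exact: inv_green_continuous.
- by move=> Q0; exact: inv_green_no_extension.
- exact: qnorm_inv_green_at0.
Qed.
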